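(* Let $T=S_0\cup S_1\cup S_2\cup S_3$ be a tent with two given cyclic quotient singularities in reduced form $S_1=\frac1r(\alpha,1)$ and $S_3=\frac1s(\beta,1)$. Write $\xi=x_k$ and $\eta=y_l$. Then toric extensions $T\subset V_{AB}$ that smooth the $\xi$- and $\eta$-axes correspond one-to-one (up to isomorphism compatible with the $x_i,y_j,A,B$) with matrices $$\begin{pmatrix} r&a\\ b&s\end{pmatrix}\in\mathrm{SL}(2,\mathbb Z)\quad\text{with } a,b\ge0,\quad a\equiv\alpha\bmod r,\quad b\equiv\beta\bmod s,$$ the matrix being determined by the relations $x_0=(A\eta^{-1})^r\xi^a$ and $y_0=\eta^b(B\xi^{-1})^s$ in the character lattice of $V_{AB}$. Moreover, if $(r,s)\ne(1,1)$, then every such matrix satisfies $$\text{either}\quad a=\alpha\mid rs-1 \ \text{ and }\ b=\frac{rs-1}{\alpha},\qquad\text{or}\quad b=\beta\mid rs-1\ \text{ and }\ a=\frac{rs-1}{\beta},$$ and there are $0$, $1$ or $2$ solutions.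
   Context: We work over $\mathbb C$. Cyclic quotients: for $r\ge1$ and $\alpha$ coprime to $r$, $\frac1r(\alpha,1)$ denotes the quotient $\mathbb A^2_{\langle u,v\rangle}/(\mathbb Z/r)$ by $(u,v)\mapsto(\varepsilon^{\alpha}u,\varepsilon v)$, $\varepsilon$ a primitive $r$th root of 1. Reduced form means $0<\alpha<r$ if $r\ge2$, and $\alpha=0$ if $r=1$ (when the quotient is $\mathbb A^2$). The coordinate ring is minimally generated by the invariant monomials on the Newton boundary; ordered from $x_0=u^r$ to $x_k=v^r$ these are $x_0,\dots,x_k$ ($k=1$ if $r=1$). Tent: let $S_1=\frac1r(\alpha,1)\subset\mathbb A^{k+1}_{\langle x_0,\dots,x_k\rangle}$ and $S_3=\frac1s(\beta,1)\subset\mathbb A^{l+1}_{\langle y_0,\dots,y_l\rangle}$, with $y_j$ the analogous generators from $y_0=u^s$ to $y_l=v^s$. The tent $T=S_0\cup S_1\cup S_2\cup S_3\subset\mathbb A^{k+l+2}$ is defined by the ideals of $S_1$ and $S_3$ together with $x_iy_j=0$ for all $(i,j)\ne(0,0),(k,l)$; here $S_0=\mathbb A^2_{\langle x_0,y_0\rangle}$, $S_2=\mathbb A^2_{\langle x_k,y_l\rangle}$. Toric extension smoothing the $\xi$- and $\eta$-axes: a normal affine toric variety $V_{AB}=\operatorname{Spec}\mathbb C[N]$ of dimension 4, where $N$ is a saturated finitely generated monoid in its character lattice $\mathbb M\cong\mathbb Z^4$ (written multiplicatively), generated by characters $A,B$ and $x_0,\dots,x_k,y_0,\dots,y_l$,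 such that $A,B$ is a regular sequence in $\mathbb C[N]$, the subscheme $A=B=0$ is $T$ (with the characters $x_i,y_j$ restricting to the coordinates of $T$) and is a union of toric strata of $V_{AB}$, and such that $x_{k-1}y_l=A\,x_k^{a_k}$ and $x_ky_{l-1}=B\,y_l^{b_l}$ in $\mathbb M$ for some integers $a_k,b_l$ (so $V_{AB}$ is nonsingular along the punctured $\xi$- and $\eta$-axes). *)

(* Defs.v *)
From HB Require Import structures.
From mathcomp Require Import all_boot all_order all_algebra finmap.
From mathcomp Require Import boolp reals complex.
From mathcomp Require monalg mpoly.

Set Implicit Arguments.
Unset Strict Implicit.
Unset Printing Implicit Defensive.

Import GRing.Theory Num.Theory.
Local Open Scope ring_scope.

(* The monoid algebra R[N] of a commutative monoid N, written additively.
   The carrier is {malg R[N]}; the library only equips it with a product when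
   N has no nontrivial invertible element, an assumption not made here. *)

Definition monoid_alg (N : nmodType) (R : comNzRingType) := @monalg.malg N R.

Section MonoidAlgebra.
Import monalg.
Variables (N : nmodType) (R : comNzRingType).

HB.instance Definition _ := GRing.Lmodule.on (monoid_alg N R).

Implicit Types (f g h : monoid_alg N R) (p q : N) (c d : R).

Definition malg_one : monoid_alg N R := << 1 *g 0 >>.

Definition malg_mul f g : monoid_alg N R :=
  \sum_(p <- msupp f) \sum_(q <- msupp g) << mcoeff p f * mcoeff q g *g p + q >>.

Lemma malg_mulw (P Q : {fset N}) f g :
  (msupp f `<=` P)%fset -> (msupp g `<=` Q)%fset ->
  malg_mul f g =
    \sum_(p <- P) \sum_(q <- Q) << mcoeff p f * mcoeff q g *g p + q >>.
Proof.
move=> leP leQ; rewrite /malg_mul (big_fset_incl _ leP) /=.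
  apply: eq_bigr => p _; apply: big_fset_incl => // q _ /mcoeff_outdom ->.
  by rewrite mulr0 monalgU0.
move=> p _ /mcoeff_outdom fp; rewrite big1 // => q _.
by rewrite fp mul0r monalgU0.
Qed.

Lemma malg_mulC : commutative malg_mul.
Proof.
move=> f g; rewrite /malg_mul exchange_big /=; apply: eq_bigr => q _.
by apply: eq_bigr => p _; rewrite mulrC addrC.
Qed.

Lemma malg_mul0 : left_zero 0 malg_mul.
Proof. by move=> f; rewrite /malg_mul msupp0 big_seq_fset0. Qed.

Lemma malg_mulUU c d p q :
  malg_mul << c *g p >> << d *g q >> = << c * d *g p + q >>.
Proof.
by rewrite (malg_mulw msuppU_le msuppU_le) !big_seq_fset1 !mcoeffUU.
Qed.

Lemma malg_mulDl : left_distributive malg_mul +%R.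
Proof.
move=> f g h; set P := (msupp f `|` msupp g)%fset.
rewrite (@malg_mulw P (msupp h) (f + g)) ?msuppD_le ?fsubset_refl //.
rewrite (@malg_mulw P (msupp h) f) ?fsubsetUl ?fsubset_refl //.
rewrite (@malg_mulw P (msupp h) g) ?fsubsetUr ?fsubset_refl //.
rewrite -big_split /=; apply: eq_bigr => p _.
rewrite -big_split /=; apply: eq_bigr => q _.
by rewrite mcoeffD mulrDl monalgUD.
Qed.

Lemma malg_mulDr : right_distributive malg_mul +%R.
Proof. by move=> f g h; rewrite malg_mulC malg_mulDl !(malg_mulC f). Qed.

Lemma malg_mul_suml (I : Type) (s : seq I) (F : I -> monoid_alg N R) g :
  malg_mul (\sum_(i <- s) F i) g = \sum_(i <- s) malg_mul (F i) g.
Proof.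
exact: (big_morph (malg_mul^~ g) (fun f h => malg_mulDl f h g) (malg_mul0 g)).
Qed.

Lemma malg_mul_sumr (I : Type) (s : seq I) (F : I -> monoid_alg N R) g :
  malg_mul g (\sum_(i <- s) F i) = \sum_(i <- s) malg_mul g (F i).
Proof.
rewrite malg_mulC malg_mul_suml.
by apply: eq_bigr => i _; rewrite malg_mulC.
Qed.

Lemma malg_mulA : associative malg_mul.
Proof.
have sum1 f g : malg_mul f g = \sum_(p <- msupp f) malg_mul << f@_p *g p >> g.
  by rewrite {1}[f]monalgE malg_mul_suml.
have U1 c p f g : malg_mul << c *g p >> (malg_mul f g)
                = malg_mul (malg_mul << c *g p >> f) g.
  rewrite (sum1 f) [f in RHS]monalgE (malg_mul_sumr _ _ << c *g p >>).
  rewrite (malg_mul_sumr (msupp f) (fun q => << f@_q *g q >>)).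
  rewrite (malg_mul_suml (msupp f)
             (fun q => malg_mul << c *g p >> << f@_q *g q >>)).
  apply: eq_bigr => q _; rewrite malg_mulUU [g]monalgE.
  rewrite 2!(malg_mul_sumr (msupp g) (fun t => << g@_t *g t >>)).
  rewrite (malg_mul_sumr (msupp g)
             (fun t => malg_mul << f@_q *g q >> << g@_t *g t >>)).
  by apply: eq_bigr => t _; rewrite !malg_mulUU mulrA addrA.
move=> f g h; rewrite sum1 (sum1 f g).
rewrite (malg_mul_suml (msupp f) (fun p => malg_mul << f@_p *g p >> g)).
by apply: eq_bigr => p _; exact: U1.
Qed.

Lemma malg_mul1 : left_id malg_one malg_mul.
Proof.
move=> f; rewrite [f]monalgE malg_mul_sumr; apply: eq_bigr => p _.
by rewrite malg_mulUU mul1r add0r.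
Qed.

Lemma malg_one_neq0 : malg_one != 0.
Proof. by rewrite /malg_one monalgU_eq0 oner_eq0. Qed.

HB.instance Definition _ := GRing.Zmodule_isComNzRing.Build (monoid_alg N R)
  malg_mulA malg_mulC malg_mul1 malg_mulDl malg_one_neq0.

Lemma malg_scaleAl c f g : c *: (f * g) = (c *: f) * g.
Proof.
have scaleE h : c *: h = malg_mul << c *g 0 >> h.
  rewrite [h in RHS]monalgE malg_mul_sumr -[LHS]/(fgscale c h) /fgscale.
  by apply: eq_bigr => p _; rewrite malg_mulUU add0r.
by rewrite !scaleE; apply: malg_mulA.
Qed.

HB.instance Definition _ :=
  GRing.Lmodule_isLalgebra.Build R (monoid_alg N R) malg_scaleAl.
HB.instance Definition _ :=
  GRing.Lalgebra_isComAlgebra.Build R (monoid_alg N R).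

Definition character p : monoid_alg N R := << 1 *g p >>.

Definition coefficient p f : R := mcoeff p f.

End MonoidAlgebra.

Import mpoly.

Section CommutativeAlgebra.
Variable S : comNzRingType.

Definition in_ideal (G : S -> Prop) (f : S) : Prop :=
  exists n (c g : 'I_n -> S),
    (forall i, G (g i)) /\ f = \sum_(i < n) c i * g i.

Definition regular_sequence2 (a b : S) : Prop :=
  [/\ forall f, a * f = 0 -> f = 0,
      forall f, in_ideal (eq a) (b * f) -> in_ideal (eq a) f
    & ~ in_ideal (fun g => g = a \/ g = b) 1].

End CommutativeAlgebra.

Definition reduced_form (r alpha : nat) : Prop :=
  [/\ (0 < r)%N, coprime alpha r &
      if r == 1%N then alpha = 0%N else (0 < alpha < r)%N].

Section CyclicQuotient.
Variables (K : fieldType) (r alpha : nat).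

(* Monomials of K[u,v] are given by their exponents. *)
Definition uv (m : nat * nat) : {mpoly K[2]} := 'X_ord0 ^+ m.1 * 'X_ord_max ^+ m.2.

Definition cyclic_act (eps : K) (p : {mpoly K[2]}) : {mpoly K[2]} :=
  p \mPo [tuple eps ^+ alpha *: 'X_ord0; eps *: 'X_ord_max].

Definition invariant_monomial (m : nat * nat) : Prop :=
  forall eps : K, r.-primitive_root eps -> cyclic_act eps (uv m) = uv m.

Definition weight (w m : nat * nat) : nat := (w.1 * m.1 + w.2 * m.2)%N.

(* The Newton boundary is the union of the compact faces of the Newton polygon,
   the convex hull of the nonconstant invariant monomials; such a face is the
   locus where a linear form with positive coefficients is minimal. *)
Definition newton_boundary (m : nat * nat) : Prop :=
  [/\ invariant_monomial m, m != (0, 0)%N &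
      exists w : nat * nat, [/\ (0 < w.1)%N, (0 < w.2)%N &
        forall m' : nat * nat, invariant_monomial m' -> m' != (0, 0)%N ->
          (weight w m <= weight w m')%N]].

(* Ordered from u^r to v^r. Every point of the Newton boundary has both
   exponents at most r, because u^r and v^r are invariant. *)
Definition newton_monomials : seq (nat * nat) :=
  [seq m <- [seq (i, j) | i <- rev (iota 0 r.+1), j <- iota 0 r.+1]
  | `[< newton_boundary m >]].

(* The index k of the last generator x_k. *)
Definition cq_top : nat := (size newton_monomials).-1.

Definition cq_gen (i : 'I_cq_top.+1) : nat * nat := nth (0, 0)%N newton_monomials i.

(* The ideal of the quotient embedded by the invariants x_0, ..., x_k: the
   relations between these monomials in K[u,v]. *)
Definition cq_ideal (p : {mpoly K[cq_top.+1]}) : Prop :=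
  p \mPo [tuple uv (cq_gen i) | i < cq_top.+1] = 0.

End CyclicQuotient.

Section Tent.
Variables (K : fieldType) (r alpha s beta : nat).

Local Notation k := (cq_top K r alpha).
Local Notation l := (cq_top K s beta).

(* The coordinates x_0, ..., x_k, y_0, ..., y_l in this order. *)
Definition tent_X (i : 'I_k.+1) : {mpoly K[k.+1 + l.+1]} := 'X_(lshift l.+1 i).
Definition tent_Y (j : 'I_l.+1) : {mpoly K[k.+1 + l.+1]} := 'X_(rshift k.+1 j).

Variant tent_equation : {mpoly K[k.+1 + l.+1]} -> Prop :=
| TentS1 p of cq_ideal p :
    tent_equation (p \mPo [tuple tent_X i | i < k.+1])
| TentS3 q of cq_ideal q :
    tent_equation (q \mPo [tuple tent_Y j | j < l.+1])
| TentXY i j of (i, j) <> (ord0, ord0) & (i, j) <> (ord_max, ord_max) :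
    tent_equation (tent_X i * tent_Y j).

Definition tent_ideal : {mpoly K[k.+1 + l.+1]} -> Prop := in_ideal tent_equation.

End Tent.

(* A monoid N mapping to the lattice Z^4 with marked elements. The lattice is
   written additively: x^n y is  x *+ n + y. *)
Record toric_data (k l : nat) := ToricData {
  td_N :> nmodType;
  td_chi : {additive td_N -> 'rV[int]_4};
  td_A : td_N;
  td_B : td_N;
  td_x : 'I_k.+1 -> td_N;
  td_y : 'I_l.+1 -> td_N
}.

Arguments td_chi {k l} _.
Arguments td_A {k l} _.
Arguments td_B {k l} _.
Arguments td_x {k l} _ _.
Arguments td_y {k l} _ _.

Definition td_xi k l (E : toric_data k l) : 'rV[int]_4 := td_chi E (td_x E ord_max).
Definition td_eta k l (E : toric_data k l) : 'rV[int]_4 := td_chi E (td_y E ord_max).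

Section Strata.
Variables (K : fieldType) (N : nmodType).

Definition face (F : N -> Prop) : Prop :=
  F 0 /\ forall p q, F (p + q) <-> F p /\ F q.

(* The ideal of the toric stratum (orbit closure) Spec K[F] in Spec K[N]. *)
Definition stratum_ideal (F : N -> Prop) (f : monoid_alg N K) : Prop :=
  forall p, F p -> coefficient p f = 0.

Definition union_of_strata (J : monoid_alg N K -> Prop) : Prop :=
  exists Fs : (N -> Prop) -> Prop,
    (forall F, Fs F -> face F) /\
    (forall f, J f <-> forall F, Fs F -> stratum_ideal F f).

End Strata.

Section ToricExtension.
Variables (K : fieldType) (r alpha s beta : nat).

Local Notation k := (cq_top K r alpha).
Local Notation l := (cq_top K s beta).
Local Notation data := (toric_data k l).

Definition td_coord (E : data) (t : 'I_(k.+1 + l.+1)) : E :=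
  match split t with inl i => td_x E i | inr j => td_y E j end.

(* K[x_0, ..., x_k, y_0, ..., y_l] -> K[N] *)
Definition td_eval (E : data) (p : {mpoly K[k.+1 + l.+1]}) : monoid_alg E K :=
  mmap (in_alg (monoid_alg E K)) (fun t => character K (td_coord E t)) p.

Definition td_ideal (E : data) : monoid_alg E K -> Prop :=
  in_ideal (fun g => g = character K (td_A E) \/ g = character K (td_B E)).

Record toric_extension (E : data) : Prop := ToricExtension {
  te_injective : injective (td_chi E);
  te_lattice : forall m, exists p q, m = td_chi E p - td_chi E q;
  te_saturated : forall m n, (0 < n)%N ->
    (exists p, td_chi E p = m *+ n) -> exists q, td_chi E q = m;
  te_generated : forall p : E,
    exists (i j : nat) (c : 'I_k.+1 -> nat) (d : 'I_l.+1 -> nat),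
      p = td_A E *+ i + td_B E *+ j
          + \sum_t td_x E t *+ c t + \sum_t td_y E t *+ d t;
  te_regular :
    regular_sequence2 (character K (td_A E)) (character K (td_B E));
  (* K[x,y] -> K[N]/(A,B) is surjective with kernel the ideal of the tent *)
  te_tent_onto : forall f : monoid_alg E K, exists p, td_ideal (f - td_eval E p);
  te_tent_kernel : forall p, td_ideal (td_eval E p) <-> tent_ideal p;
  te_strata : union_of_strata (@td_ideal E);
  te_smooth_xi : exists a_k : int,
    td_chi E (td_x E (inord k.-1)) + td_eta E
      = td_chi E (td_A E) + td_xi E *~ a_k;
  te_smooth_eta : exists b_l : int,
    td_xi E + td_chi E (td_y E (inord l.-1))
      = td_chi E (td_B E) + td_eta E *~ b_l
}.

(* Isomorphism of the affine varieties Spec K[N], given on coordinate rings. *)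
Definition toric_extension_iso (E E' : data) : Prop :=
  exists g : {lrmorphism monoid_alg E K -> monoid_alg E' K},
    [/\ bijective g,
        g (character K (td_A E)) = character K (td_A E'),
        g (character K (td_B E)) = character K (td_B E'),
        forall i, g (character K (td_x E i)) = character K (td_x E' i)
      & forall j, g (character K (td_y E j)) = character K (td_y E' j)].

(* The relations x_0 = (A eta^-1)^r xi^a and y_0 = eta^b (B xi^-1)^s for the
   matrix (r a; b s). *)
Definition extension_matrix (E : data) (M : 'M[int]_2) : Prop :=
  [/\ M 0 0 = r%:Z, M 1 1 = s%:Z,
      td_chi E (td_x E ord0)
        = (td_chi E (td_A E) - td_eta E) *~ M 0 0 + td_xi E *~ M 0 1
    & td_chi E (td_y E ord0)
        = td_eta E *~ M 1 0 + (td_chi E (td_B E) - td_xi E) *~ M 1 1].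

End ToricExtension.

Definition admissible_matrix (r alpha s beta : nat) (M : 'M[int]_2) : Prop :=
  [/\ M 0 0 = r%:Z /\ M 1 1 = s%:Z,
      \det M = 1,
      0 <= M 0 1 /\ 0 <= M 1 0,
      (M 0%R 1%R = alpha%:Z %[mod r%:Z])%Z
    & (M 1%R 0%R = beta%:Z %[mod s%:Z])%Z].

(* Main.v *)
(* The relations x_(k-1) eta = A xi^(a_k) and y_(l-1) xi = B eta^(b_l) show that
   A, B, xi, eta is a basis of the lattice, and the relations between the
   generators of S_1 and S_3 then give x_0 = (A/eta)^r xi^a and
   y_0 = (B/xi)^s eta^b with a = alpha mod r and b = beta mod s. At the opposite
   corner, the tent equations x_i y_0 = 0 and x_0 y_j = 0 force N, modulo the face
   generated by x_0 and y_0, to be generated by A and B. So A, B, x_0, y_0 is also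
   a basis, in which xi and eta have nonnegative A- and B-exponents; comparing the
   two bases gives rs - ab = 1 and a, b >= 0. As the matrix determines every x_i
   and y_j in terms of A, B, xi, eta, it determines the extension.
   Conversely, for given a and b, N is the set of lattice points of a cone cut
   out by six inequalities, three for A and three for B. A monomial divisible
   neither by A nor by B is on the boundary for one inequality of each kind, hence
   in one of the four faces of the tent. Finally a >= r and b >= s would give
   ab >= rs, so a < r or b < s. *)

Require Import Defs.
From HB Require Import structures.
From mathcomp Require Import all_boot all_order all_algebra.
From mathcomp Require Import finmap cyclic separable cyclotomic.
From mathcomp Require Import zify ring lra.
From mathcomp Require Import boolp reals complex.
From mathcomp Require monalg mpoly.
Import GRing.Theory Num.Theory.
Local Open Scope ring_scope.

Set Implicit Arguments.
Unset Strict Implicit.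
Unset Printing Implicit Defensive.
Import Order.TTheory.

(** * Cyclic quotients and their Newton boundary *)

(** The ideal (A, B) of C[N] is spanned by characters. Hence a binomial of the tent ideal whose
    terms do not vanish on T is an equality in N itself, and nonvanishing is seen at a suitable
    point of T; this lifts the relations of S_1 and S_3 to the lattice. Comparing the two bases
    leaves the sign in rs - ab = 1 or -1 open; it is settled by the A- and B-exponents of xi and eta
    being nonnegative at the opposite corner. The six forms of the cone are exponents in lattice
    bases: the A- and B-exponent in A, B, xi, eta; the A-exponent in A, B, xi, x_(k-1); the
    B-exponent in A, B, eta, y_(l-1); the A- and B-exponent in A, B, x_0, y_0. The face of each S_i
    is cut out by one A-form and one B-form. That the faces of S_1 and S_3 contain nothing beyond
    monomials in the x_i or in the y_j requires that the Newton boundary generate all invariant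
    monomials, which is a convexity argument. Once monomials and binomials are understood, general
    elements of the ideals are handled by grouping their terms according to the character in N. *)

Lemma closed_field_prim_root (F : closedFieldType) n :
  n%:R != 0 :> F -> exists z : F, n.-primitive_root z.
Proof.
move=> n_neq0; have n_gt0 : (0 < n)%N by case: n n_neq0 => //; rewrite eqxx.
pose p : {poly F} := 'X^n - 1.
have [rs Dp] := closed_field_poly_normal p.
have Ep : p = \prod_(z <- rs) ('X - z%:P).
  by rewrite Dp (monicP _) ?monicXnsubC // scale1r.
have rn1 : all n.-unity_root rs by apply/allP=> z; rewrite -root_prod_XsubC -Ep.
have sz_rs : (n < (size rs).+1)%N.
  by rewrite -(size_prod_XsubC rs id) -Ep size_XnsubC.
have [|z] := hasP (has_prim_root n_gt0 rn1 _ sz_rs); last by exists z.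
rewrite -separable_prod_XsubC -Ep separable_Xn_sub_1 //.
Qed.

Section Invariants.
Import mpoly.
Variables (K : fieldType) (r alpha : nat).
Hypothesis prim : exists z : K, r.-primitive_root z.

Lemma uvE m : uv K m = 'X_[U_(ord0) *+ m.1 + U_(ord_max) *+ m.2].
Proof. by rewrite /uv mpolyXD !mpolyXn. Qed.

Lemma uv_inj : injective (uv K).
Proof.
move=> m m'; rewrite !uvE => /(congr1 (mcoeff (U_(ord0) *+ m.1 + U_(ord_max) *+ m.2)%MM)).
rewrite !mcoeffX eqxx; case: eqP => [E _|_ /eqP]; last by rewrite oner_eq0.
have := congr1 (fun f : 'X_{1..2} => f ord0) E.
have := congr1 (fun f : 'X_{1..2} => f ord_max) E.
rewrite !mnmDE !mulmnE !mnm1E /= !mul0n !mul1n !addn0 !add0n.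
by case: m {E}; case: m' => ? ? ? ? /= -> ->.
Qed.

Lemma cyclic_act_uv eps m :
  cyclic_act alpha eps (uv K m) = eps ^+ (alpha * m.1 + m.2) *: uv K m.
Proof.
rewrite /cyclic_act /uv rmorphM !rmorphXn /= !comp_mpolyXU /=.
by rewrite !exprZn -scalerAl -scalerAr scalerA exprD exprM.
Qed.

(** The existence of a primitive root keeps the quantifier over [eps] from being vacuous; the action
    multiplies a monomial by a power of [eps]. *)
Lemma invariant_monomialE m :
  invariant_monomial K r alpha m <-> (r %| alpha * m.1 + m.2)%N.
Proof.
rewrite /invariant_monomial; split=> [inv | dvd eps prim_eps].
  have [eps prim_eps] := prim; rewrite (prim_order_dvd prim_eps).
  have := inv _ prim_eps; rewrite cyclic_act_uv => /(congr1 (mcoeff (U_(ord0) *+ m.1 +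
    U_(ord_max) *+ m.2)%MM)).
  by rewrite mcoeffZ uvE mcoeffX eqxx mulr1 => ->.
by rewrite cyclic_act_uv; move: dvd; rewrite (prim_order_dvd prim_eps) => /eqP ->;
  rewrite scale1r.
Qed.
End Invariants.

(** * Supporting lines of a convex polygon, in natural numbers *)

Section WeightOnEdge.
Local Open Scope nat_scope.

Lemma leq_addP m n : m <= n -> exists d, n = m + d.
Proof. by move=> /subnKC <-; eexists. Qed.

(** Convexity at [b]: since [c] lies on or above the level line of [v] through [b], that line
    descends at least as steeply as [bc]. Left of [b] it therefore runs above the line [bc], and [p]
    is above it. *)
Lemma weight_edge_left v1 v2 p1 p2 b1 b2 c1 c2 :
  0 < v2 -> p1 <= b1 -> b1 < c1 -> c2 < b2 ->
  v1 * b1 + v2 * b2 <= v1 * p1 + v2 * p2 ->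
  v1 * b1 + v2 * b2 <= v1 * c1 + v2 * c2 ->
  (b2 - c2) * b1 + (c1 - b1) * b2 <= (b2 - c2) * p1 + (c1 - b1) * p2.
Proof.
move=> v2_gt0 /leq_addP[a ->] /ltnW/leq_addP[D ->] /ltnW/leq_addP[H ->].
rewrite !addKn => vp vc.
have l1 : v2 * H <= v1 * D by lia.
have l2 : v2 * (c2 + H) + v1 * a <= v2 * p2 by lia.
have l3 : v2 * (H * a) <= v1 * a * D by rewrite mulnA [leqRHS]mulnAC leq_mul2r l1 orbT.
have l4 : v2 * (c2 + H) * D + v1 * a * D <= v2 * p2 * D.
  by rewrite -mulnDl leq_mul2r l2 orbT.
rewrite -(leq_pmul2l v2_gt0); lia.
Qed.

(** The mirror image at [c]: here the level line of [v] through [c] is at most as steep as [bc] and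
    runs above it to the right of [c]. *)
Lemma weight_edge_right v1 v2 p1 p2 b1 b2 c1 c2 :
  0 < v2 -> c1 <= p1 -> b1 < c1 -> c2 < b2 ->
  v1 * c1 + v2 * c2 <= v1 * p1 + v2 * p2 ->
  v1 * c1 + v2 * c2 <= v1 * b1 + v2 * b2 ->
  (b2 - c2) * b1 + (c1 - b1) * b2 <= (b2 - c2) * p1 + (c1 - b1) * p2.
Proof.
move=> v2_gt0 /leq_addP[a ->] /ltnW/leq_addP[D ->] /ltnW/leq_addP[H ->].
rewrite !addKn => vp vb.
have l1 : v1 * D <= v2 * H by lia.
have l2 : v2 * c2 <= v1 * a + v2 * p2 by lia.
have l3 : v1 * D * a <= v2 * H * a by rewrite leq_mul2r l1 orbT.
have l4 : v2 * c2 * D <= (v1 * a + v2 * p2) * D by rewrite leq_mul2r l2 orbT.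
rewrite -(leq_pmul2l v2_gt0); lia.
Qed.

Lemma weight_edge_box n1 n2 b1 b2 c1 c2 :
  b1 < c1 -> c2 < b2 -> n1 = b1 /\ n2 <= b2 \/ n1 = c1 /\ c2 <= n2 ->
  (b2 - c2) * n1 + (c1 - b1) * n2 = (b2 - c2) * b1 + (c1 - b1) * b2 ->
  (n1, n2) = (b1, b2) \/ (n1, n2) = (c1, c2).
Proof.
move=> /[dup] lt /ltnW/leq_addP[D ED] /ltnW/leq_addP[H ->]; subst c1.
have D_gt0 : 0 < D by lia.
rewrite !addKn; case=> -[-> le] E; [left | right].
  have /eqP : D * n2 = D * (c2 + H) by lia.
  by rewrite eqn_pmul2l // => /eqP ->.
have /eqP : D * n2 = D * c2 by lia.
by rewrite eqn_pmul2l // => /eqP ->.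
Qed.

(** The form takes equal values at [b] and [c], so reflection in the midpoint of [bc] sends a point
    above the segment to one below it. The subtractions do not truncate because [m] lies in the
    box. *)
Lemma weight_box_reflect m1 m2 b1 b2 c1 c2 :
  b1 <= m1 -> m1 < c1 -> c2 <= m2 -> m2 < b2 ->
  (b2 - c2) * b1 + (c1 - b1) * b2 < (b2 - c2) * m1 + (c1 - b1) * m2 ->
  (b2 - c2) * (b1 + c1 - m1) + (c1 - b1) * (b2 + c2 - m2)
    <= (b2 - c2) * b1 + (c1 - b1) * b2.
Proof.
move=> /leq_addP[x ->] /ltnW/leq_addP[x' ->] /leq_addP[y ->] /ltnW/leq_addP[y' ->].
have -> : c2 + y + y' - c2 = y + y' by lia.
have -> : b1 + x + x' - b1 = x + x' by lia.
have -> : b1 + (b1 + x + x') - (b1 + x) = b1 + x' by lia.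
have -> : c2 + y + y' + c2 - (c2 + y) = c2 + y' by lia.
lia.
Qed.

End WeightOnEdge.

(** * The Newton boundary generates the invariant monomials *)

Section Newton.
Local Open Scope nat_scope.
Variables (K : fieldType) (r alpha : nat).
Hypothesis prim : exists z : K, r.-primitive_root z.
Hypothesis red : reduced_form r alpha.

Local Notation inv m := (r %| alpha * m.1 + m.2).
Local Notation nb := (newton_boundary K r alpha).

Lemma newton_boundaryI m w : inv m -> m != (0, 0) -> 0 < w.1 -> 0 < w.2 ->
  (forall m', inv m' -> m' != (0, 0) -> weight w m <= weight w m') -> nb m.
Proof.
move=> im m0 w1 w2 le; split=> //; first exact/invariant_monomialE.
by exists w; split=> // m' /(invariant_monomialE _ prim); apply: le.
Qed.

Lemma newton_boundary_inv m : nb m -> inv m.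
Proof. by case=> /(invariant_monomialE _ prim). Qed.

Lemma newton_boundary_weight m : nb m -> exists w : nat * nat,
  [/\ 0 < w.1, 0 < w.2 & forall m', inv m' -> m' != (0, 0) -> weight w m <= weight w m'].
Proof.
case=> _ _ [w [w1 w2 le]]; exists w; split=> // m' im'.
by apply: le; apply/invariant_monomialE.
Qed.

Let r_gt0 : 0 < r. Proof. by case: red. Qed.

Lemma pair_neq00 (i j : nat) : ((i, j) != (0, 0)) = (0 < i) || (0 < j).
Proof. by rewrite xpair_eqE negb_and !lt0n. Qed.

Lemma coprime_dvd_l i : r %| alpha * i -> r %| i.
Proof. by case: red => _ co _; rewrite Gauss_dvdr // coprime_sym. Qed.

(** For the weight [(1, r)] only points [(i, 0)] could lie below [(r, 0)], and for these coprimality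
    gives that [r] divides [i]. *)
Lemma newton_boundary_r0 : nb (r, 0).
Proof.
apply: (@newton_boundaryI _ (1, r)) => //=.
- by rewrite addn0 dvdn_mull.
- by rewrite pair_neq00 r_gt0.
move=> [i [|j]] /=; rewrite /weight /= ?pair_neq00.
  rewrite addn0 => /coprime_dvd_l /dvdn_leq H; rewrite orbF => /H.
  by rewrite !muln0 !addn0 !mul1n.
by move=> _ _; nia.
Qed.

Lemma newton_boundary_0r : nb (0, r).
Proof.
apply: (@newton_boundaryI _ (r, 1)) => //=.
- by rewrite muln0.
- by rewrite pair_neq00 r_gt0.
move=> [[|i] j] /=; rewrite /weight /= ?pair_neq00.
  by rewrite muln0 add0n => /dvdn_leq H /H; lia.
by move=> _ _; nia.
Qed.

(* The generator x_(k-1) is u v^c with this exponent c. *)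
Definition subtop_exp := (r - alpha) %% r.

Lemma subtop_exp_dvd : r %| alpha + subtop_exp.
Proof.
case: red => _ _; rewrite /subtop_exp; case: eqP => [-> -> //|_ /andP[a0 ar]].
by rewrite modn_small ?subnKC //; lia.
Qed.

(** The form [alpha * i + j] that decides invariance is itself supporting: on nonconstant invariants
    it is a positive multiple of [r], and it equals [r] here. For [r = 1] it has a zero coefficient,
    so this case is treated apart. *)
Lemma newton_boundary_1c : nb (1, subtop_exp).
Proof.
have [r1|r1] := eqVneq r 1.
  case: red => _ _; rewrite r1 eqxx /subtop_exp => a0.
  by rewrite a0 r1 -[in (1, _ )]r1; move: newton_boundary_r0; rewrite r1 a0.
case: red => _ _; rewrite (negPf r1) => /andP[a0 ar].
have c_eq : subtop_exp = r - alpha by rewrite /subtop_exp modn_small //; lia.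
apply: (@newton_boundaryI _ (alpha, 1)) => //=; first by rewrite muln1 subtop_exp_dvd.
move=> [i j] /= d; rewrite pair_neq00 /weight /= => ij.
rewrite muln1 !mul1n c_eq; apply: leq_trans (dvdn_leq _ d); first by lia.
by case/orP: ij => ?; nia.
Qed.

(** With [b] inverse to [alpha] modulo [r], invariance also means that [r] divides [i + b * j], and
    this form has its least value [r] at [(r - b, 1)]. Together with x_0 this generator spans the
    lattice of invariant exponents, as the corner argument requires. *)
Lemma newton_boundary_c1 : exists c, nb (c, 1).
Proof.
have [r1|r1] := eqVneq r 1.
  by exists 0; move: newton_boundary_0r; rewrite r1.
have [_ co] := red; rewrite (negPf r1) => /andP[a0 ar].
have [a' [n Ea']] : exists a' n, alpha * a' = n * r + 1.
  by have [a' n E _] := egcdnP r a0; exists a', n; rewrite mulnC E (eqP co).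
pose b := a' %% r; have b_lt : b < r by rewrite ltn_mod.
have [n' Eb] : exists n', alpha * b = n' * r + 1.
  have := Ea'; rewrite {1}(divn_eq a' r) -/b => E.
  move: (a' %/ r) E => q E; have le : alpha * q <= n by nia.
  exists (n - alpha * q); rewrite mulnBl; nia.
have b_gt0 : 0 < b by case: posnP Eb => // ->; lia.
exists (r - b); apply: (@newton_boundaryI _ (1, b)) => //=.
- by apply/dvdnP; exists (alpha - n'); nia.
- by rewrite pair_neq00 orbT.
move=> [i j] /= d; rewrite pair_neq00 /weight /= => ij.
have d' : r %| 1 * i + b * j.
  apply: coprime_dvd_l; case/dvdnP: d => q Eq.
  by apply/dvdnP; exists (q + n' * j); nia.
apply: leq_trans (dvdn_leq _ d'); first by lia.
by case/orP: ij => ?; nia.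
Qed.

Lemma newton_boundary_min m m' : nb m -> inv m' -> m' != (0, 0) ->
  m'.1 <= m.1 -> m'.2 <= m.2 -> m' = m.
Proof.
move=> /newton_boundary_weight[w [w1 w2 le]] im' m0 l1 l2.
have := le _ im' m0; rewrite /weight; case: m m' l1 l2 {le im' m0} => [a b] [c d] /= ?
  ? ?.
by congr (_, _); nia.
Qed.

Lemma newton_boundary_le m : nb m -> (m.1 <= r) /\ (m.2 <= r).
Proof.
move=> bm; have [w [w1 w2 le]] := newton_boundary_weight bm.
have := le _ (newton_boundary_inv newton_boundary_r0).
have := le _ (newton_boundary_inv newton_boundary_0r).
rewrite !pair_neq00 r_gt0 orbT /weight /= => /(_ isT) ? /(_ isT) ?; split; nia.
Qed.

Lemma newton_boundary_i0 i : nb (i, 0) -> i = r.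
Proof.
move=> bi; have [] := newton_boundary_le bi; rewrite /= => le _.
case: (bi) => _ i0 _; have := newton_boundary_inv bi; rewrite /= addn0.
move=> /coprime_dvd_l/dvdn_leq; move: i0; rewrite pair_neq00 orbF => i0 /(_ i0) ?; lia.
Qed.

Lemma newton_boundary_0j j : nb (0, j) -> j = r.
Proof.
move=> bj; have [] := newton_boundary_le bj; rewrite /= => _ le.
case: (bj) => _ j0 _; have := newton_boundary_inv bj; rewrite /= muln0.
move=> /dvdn_leq; move: j0; rewrite pair_neq00 => j0 /(_ j0) ?; lia.
Qed.

Lemma newton_boundary_1j j : nb (1, j) -> j = subtop_exp.
Proof.
move=> bj; have [le|lt] := leqP subtop_exp j.
  have /= := newton_boundary_min bj (newton_boundary_inv newton_boundary_1c).
  by move=> /(_ isT (leqnn _) le) [].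
have /= := newton_boundary_min newton_boundary_1c (newton_boundary_inv bj).
by move=> /(_ isT (leqnn _) (ltnW lt)) [].
Qed.

Lemma mem_newton m : m \in newton_monomials K r alpha <-> nb m.
Proof.
rewrite mem_filter; split=> [/andP[/asboolP] //|bm].
rewrite asboolT // andTb; have [l1 l2] := newton_boundary_le bm.
by apply/allpairsPdep; exists m.1, m.2; rewrite mem_rev !mem_iota /= !ltnS l1 l2
  -surjective_pairing.
Qed.

Lemma filter_only (T : eqType) (P : pred T) (s : seq T) x :
  uniq s -> x \in s -> P x -> (forall y, P y -> y = x) -> filter P s = [:: x].
Proof.
move=> us xs Px Px_only; rewrite -(filter_pred1_uniq us xs).
by apply: eq_filter => y /=; apply/idP/eqP => [/Px_only|->].
Qed.

(** The enumeration runs through decreasing first exponents, and the rows 1 and 0 contain exactly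
    one boundary point each. This identifies x_(k-1) and x_k, the generators in the smoothness
    conditions. *)
Lemma newton_monomials_tail :
  exists s, newton_monomials K r alpha = s ++ [:: (1, subtop_exp); (0, r)].
Proof.
pose row (i : nat) := [seq (i, j) | j <- iota 0 r.+1].
have E i j0 : nb (i, j0) -> (forall j, nb (i, j) -> j = j0) ->
    [seq m <- row i | `[< nb m >]] = [:: (i, j0)].
  move=> b only; rewrite filter_map (@filter_only _ _ _ j0) ?iota_uniq //.
  - by rewrite mem_iota ltnS; have [] := newton_boundary_le b.
  - exact/asboolP.
  by move=> j /asboolP /only.
have -> : newton_monomials K r alpha
    = [seq m <- flatten [seq row i | i <- rev (iota 2 r.-1)] ++ row 1 ++ row 0 | `[< nb
      m >]].
  rewrite /newton_monomials; congr filter; rewrite -/row.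
  have -> : iota 0 r.+1 = [:: 0; 1] ++ iota 2 r.-1 by case: r r_gt0.
  by rewrite rev_cat map_cat flatten_cat /= cats0.
rewrite filter_cat filter_cat (E 1 subtop_exp) ?(E 0 r) //.
- by eexists; congr (_ ++ _).
- exact: newton_boundary_0r.
- exact: newton_boundary_0j.
- exact: newton_boundary_1c.
exact: newton_boundary_1j.
Qed.

Lemma newton_monomials_head : exists s, newton_monomials K r alpha = (r, 0) :: s.
Proof.
rewrite /newton_monomials -[in rev (iota 0 r.+1)]addn1 iotaD rev_cat /=.
by case: asboolP => [_|/(_ newton_boundary_r0) //]; eexists.
Qed.

Lemma newton_monomials_uniq : uniq (newton_monomials K r alpha).
Proof.
apply/filter_uniq/allpairs_uniq_dep => [|i _|]; rewrite ?rev_uniq ?iota_uniq //.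
by move=> [? ?] [? ?] _ _ [-> ->].
Qed.

Local Notation k := (cq_top K r alpha).
Local Notation gen := (@cq_gen K r alpha).

Lemma cq_top_gt0 : 0 < k.
Proof.
by have [s E] := newton_monomials_tail; rewrite /cq_top E size_cat /= addn2.
Qed.

Lemma size_newton : size (newton_monomials K r alpha) = k.+1.
Proof.
by have [s E] := newton_monomials_tail; rewrite /cq_top E size_cat /= addn2.
Qed.

Lemma cq_gen0 : gen ord0 = (r, 0).
Proof. by have [s E] := newton_monomials_head; rewrite /cq_gen E. Qed.

Lemma cq_gen_top : gen ord_max = (0, r).
Proof.
have [s E] := newton_monomials_tail; rewrite /cq_gen /= /cq_top E size_cat nth_cat /=.
by rewrite addn2 /= ltnNge leqnSn /= subSn // subnn.
Qed.

Lemma cq_gen_subtop : gen (inord k.-1) = (1, subtop_exp).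
Proof.
rewrite /cq_gen inordK; last by have := cq_top_gt0; lia.
have [s E] := newton_monomials_tail; rewrite /cq_top E size_cat nth_cat /=.
by rewrite addn2 /= ltnn subnn.
Qed.

Lemma cq_gen_nb i : nb (gen i).
Proof. by apply/mem_newton; rewrite mem_nth // size_newton. Qed.

Lemma cq_gen_inv i : inv (gen i).
Proof. exact/newton_boundary_inv/cq_gen_nb. Qed.

Lemma cq_gen_ex m : nb m -> exists i, gen i = m.
Proof.
move=> /mem_newton ms; have lt : index m (newton_monomials K r alpha) < k.+1.
  by rewrite -size_newton index_mem.
by exists (Ordinal lt); rewrite /cq_gen /= nth_index.
Qed.

Lemma cq_gen_inj : injective gen.
Proof.
move=> i j /eqP; rewrite /cq_gen nth_uniq ?size_newton ?newton_monomials_uniq //.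
by move/eqP/ord_inj.
Qed.

Lemma cq_gen2_eq0 i : ((gen i).2 == 0) = (i == ord0).
Proof.
apply/eqP/eqP => [|->]; last by rewrite cq_gen0.
move=> E; apply: cq_gen_inj; rewrite cq_gen0.
have := cq_gen_nb i; rewrite [gen i]surjective_pairing E => /newton_boundary_i0 ->.
by [].
Qed.

Lemma cq_gen1_eq0 i : ((gen i).1 == 0) = (i == ord_max).
Proof.
apply/eqP/eqP => [|->]; last by rewrite cq_gen_top.
move=> E; apply: cq_gen_inj; rewrite cq_gen_top.
have := cq_gen_nb i; rewrite [gen i]surjective_pairing E => /newton_boundary_0j ->.
by [].
Qed.

Lemma weight_minimizer w : 0 < w.1 -> 0 < w.2 ->
  exists p, [/\ nb p & forall m, inv m -> m != (0, 0) -> weight w p <= weight w m].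
Proof.
move=> w1 w2; pose P n := `[< exists m, [/\ inv m, m != (0, 0) & weight w m = n] >].
have exP : exists n, P n.
  exists (weight w (r, 0)); apply/asboolP; exists (r, 0).
  by split=> //; [exact/newton_boundary_inv/newton_boundary_r0 | rewrite pair_neq00
    r_gt0].
case: (ex_minnP exP) => n /asboolP[p [ip p0 <-]] le.
have le' m : inv m -> m != (0, 0) -> weight w p <= weight w m.
  by move=> im m0; apply: le; apply/asboolP; exists m.
by exists p; split=> //; apply: (@newton_boundaryI _ w).
Qed.

(* Let b and c be the boundary monomials next to m on both sides. If neither
   divides m, then m and b + c - m lie in the box spanned by b and c, and one of
   them is on or below the segment bc; this contradicts the fact that b and c
   are neighbours on the boundary of a convex region. *)
Lemma newton_boundary_below m : inv m -> m != (0, 0) ->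
  exists b, [/\ nb b, b.1 <= m.1 & b.2 <= m.2].
Proof.
move=> im m0; have [rm|mr] := leqP r m.1.
  by exists (r, 0); split=> //; apply: newton_boundary_r0.
pose P i := `[< i <= m.1 /\ exists j, nb (i, j) >].
have exP : exists i, P i.
  by exists 0; apply/asboolP; split=> //; exists r; apply: newton_boundary_0r.
have ubP i : P i -> i <= m.1 by case/asboolP.
case: (ex_maxnP exP ubP) => b1 /asboolP[b1m [b2 bb]] b1max.
pose Q i := `[< m.1 < i /\ exists j, nb (i, j) >].
have exQ : exists i, Q i.
  by exists r; apply/asboolP; split=> //; exists 0; apply: newton_boundary_r0.
case: (ex_minnP exQ) => c1 /asboolP[c1m [c2 bc]] c1min.
have [b2m|mb2] := leqP b2 m.2; first by exists (b1, b2).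
have mc2 : c2 <= m.2.
  have [//|lt] := leqP c2 m.2.
  by have := newton_boundary_min bc im m0 (ltnW c1m) (ltnW lt) => E;
    rewrite E /= ltnn in c1m.
have sep p : nb p -> p.1 <= b1 \/ c1 <= p.1.
  move=> bp; have [lep|ltp] := leqP p.1 m.1.
    by left; apply: b1max; apply/asboolP; split=> //; exists p.2;
      rewrite -surjective_pairing.
  by right; apply: c1min; apply/asboolP; split=> //; exists p.2;
    rewrite -surjective_pairing.
(* The form that is constant on the segment [bc]. *)
pose w := (b2 - c2, c1 - b1).
have w1 : 0 < w.1 by rewrite /=; lia.
have w2 : 0 < w.2 by rewrite /=; lia.
have [n [i_n n0 [n1b n1c n2c n2b [nb_n nc_n wn]]]] : exists n, [/\ inv n, n != (0, 0) &
   [/\ b1 <= n.1, n.1 <= c1, c2 <= n.2, n.2 <= b2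
     & [/\ n != (b1, b2), n != (c1, c2) & weight w n <= weight w (b1, b2)]]].
  have ib := newton_boundary_inv bb; have ic := newton_boundary_inv bc.
  have b2c2 : c2 < b2 by lia.
  case: (leqP (weight w m) (weight w (b1, b2))) => wm.
    exists m; split=> //; split; [exact: b1m|exact: ltnW|exact: mc2|exact: ltnW|split=>
      //].
      by apply/eqP => E; rewrite E /= ltnn in mb2.
    by apply/eqP => E; rewrite E /= ltnn in c1m.
  exists (b1 + c1 - m.1, b2 + c2 - m.2); split=> /=.
  - have -> : alpha * (b1 + c1 - m.1) + (b2 + c2 - m.2)
        = (alpha * b1 + b2) + (alpha * c1 + c2) - (alpha * m.1 + m.2) by nia.
    by rewrite dvdn_sub // dvdn_add.
  - by rewrite pair_neq00; lia.
  split=> /=; [clear -c1m; lia | clear -b1m; lia | clear -mb2; lia | clear -mc2; lia |].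
  split; rewrite ?xpair_eqE; [clear -c1m; lia | clear -b1m mb2; lia |].
  move: wm; rewrite [m]surjective_pairing /weight /=; exact: weight_box_reflect.
(* If the minimum of [w] is attained on the line [bc], then [n] is a boundary point strictly between
   the neighbours [b] and [c]. Otherwise the minimizer lies strictly below that line, against the
   supporting form at [b] or at [c]. *)
have [[p1 p2] [bp pmin]] := weight_minimizer w1 w2.
have wp : weight w (p1, p2) <= weight w n := pmin _ i_n n0.
have [eqw|ltw] := leqP (weight w (b1, b2)) (weight w (p1, p2)).
  have nbn : nb n.
    apply: (@newton_boundaryI _ w) => // q iq q0.
    by apply: leq_trans (pmin _ iq q0); apply: leq_trans eqw.
  have b1c1 := leq_ltn_trans b1m c1m; have c2b2 := leq_ltn_trans mc2 mb2.
  have E : weight w n = weight w (b1, b2) by apply/eqP;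
    rewrite eqn_leq wn (leq_trans eqw wp).
  have side : n.1 = b1 /\ n.2 <= b2 \/ n.1 = c1 /\ c2 <= n.2.
    case: (sep _ nbn) => le; [left|right]; split=> //; apply/eqP; rewrite eqn_leq.
      by rewrite le n1b.
    by rewrite n1c le.
  by have [] := weight_edge_box b1c1 c2b2 side E; rewrite -surjective_pairing => /eqP;
    rewrite ?(negPf nb_n) ?(negPf nc_n).
have [ip [ib ic]] := (newton_boundary_inv bp, (newton_boundary_inv bb,
  newton_boundary_inv bc)).
have [v [v1 v2 vmin]] := newton_boundary_weight bb.
have [u [u1 u2 umin]] := newton_boundary_weight bc.
have [b0 c0 p0] : [/\ (b1, b2) != (0, 0), (c1, c2) != (0, 0) & (p1, p2) != (0, 0)].
  by split; [case: bb|case: bc|case: bp].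
have b1c1 := leq_ltn_trans b1m c1m; have c2b2 := leq_ltn_trans mc2 mb2.
have := ltw; rewrite ltnNge => /negP[]; rewrite /weight /=.
case: (sep _ bp) => /= le.
  by apply: (weight_edge_left v2 le b1c1 c2b2) (vmin _ ip p0) (vmin _ ic c0).
by apply: (weight_edge_right u2 le b1c1 c2b2) (umin _ ip p0) (umin _ ib b0).
Qed.


(** Induction on the total degree: dividing by a boundary monomial below [m] leaves an invariant
    monomial of smaller degree. *)
Lemma newton_generates m : inv m -> exists c : 'I_k.+1 -> nat,
  m = (\sum_i c i * (gen i).1, \sum_i c i * (gen i).2).
Proof.
have [n] := ubnP (m.1 + m.2); elim: n m => // n IH m ltn im.
have [->|m0] := eqVneq m (0, 0).
  by exists (fun=> 0); rewrite !big1.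
have [b [bb b1 b2]] := newton_boundary_below im m0.
have [i Ei] := cq_gen_ex bb.
have b0 : 0 < b.1 + b.2.
  by case: bb => _; rewrite [b]surjective_pairing pair_neq00 /=; lia.
have [||c Ec] := IH (m.1 - b.1, m.2 - b.2).
- by rewrite /=; lia.
- move: im (newton_boundary_inv bb) => /= im ib.
  have -> : alpha * (m.1 - b.1) + (m.2 - b.2) = (alpha * m.1 + m.2) - (alpha * b.1 +
    b.2) by nia.
  exact: dvdn_sub.
exists (fun j => c j + (j == i)); case: Ec => E1 E2.
have delta (F : 'I_k.+1 -> nat) : \sum_j (c j + (j == i)) * F j = \sum_j c j * F j + F i.
  under eq_bigr do rewrite mulnDl.
  rewrite big_split /=; congr addn; rewrite (bigD1 i) //= eqxx mul1n big1 ?addn0 //.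
  by move=> j /negPf ->.
by rewrite !delta -E1 -E2 Ei !subnK // -surjective_pairing.
Qed.

End Newton.

(** * Monoid algebras and binomial ideals *)

Section FormalRelations.

(** On each fibre of [H] the coefficients add up to zero, so the partial sum is a combination of
    differences [X i - X j] inside the fibre. With [J] an ideal or the zero subspace this passes
    from binomials to all relations. The induction removes the fibre of the first index. *)
Lemma formal_relation (K : pzRingType) (V : lmodType K) (J : V -> Prop)
    (I T : eqType) (s : seq I) (c : I -> K) (H : I -> T) (X : I -> V) :
  J 0 -> (forall u v, J u -> J v -> J (u + v)) -> (forall a v, J v -> J (a *: v)) ->
  {in s &, forall i j, H i = H j -> J (X i - X j)} ->
  (forall t, \sum_(i <- s | H i == t) c i = 0) ->
  J (\sum_(i <- s) c i *: X i).
Proof.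
move=> J0 JD JZ; have [n] := ubnP (size s); elim: n s => // n IH [|i0 s'] lt rel coef.
  by rewrite big_nil.
set s := i0 :: s' in lt rel coef *; have i0s : i0 \in s by rewrite mem_head.
have Jsum (P : pred I) (F : I -> V) : (forall i, i \in s -> P i -> J (F i)) ->
    J (\sum_(i <- s | P i) F i).
  by move=> JF; rewrite big_seq_cond; elim/big_ind: _ => // i /andP[]; apply: JF.
rewrite (bigID (fun i => H i == H i0)) /=; apply: JD.
  rewrite -[X in J X](subr0) -[X in _ - X](scale0r (X i0)) -(coef (H i0)).
  rewrite scaler_suml -sumrB; apply: Jsum => i si /eqP Hi.
  by rewrite -scalerBr; apply/JZ/rel.
rewrite -big_filter; apply: IH.
- rewrite size_filter -ltnS; apply: leq_trans lt; rewrite /= eqxx add0n ltnS.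
  exact: count_size.
- move=> i j; rewrite !mem_filter => /andP[_ si] /andP[_ sj]; exact: rel.
move=> t; rewrite big_filter_cond; have [->|ne] := eqVneq t (H i0).
  by rewrite big_pred0 // => i; rewrite andNb.
rewrite -[RHS](coef t); apply: eq_bigl => i.
by case: (eqVneq (H i) t) => [->|_]; rewrite ?ne ?andbF.
Qed.

End FormalRelations.

Section Ideals.
Variables (S : comNzRingType) (G : S -> Prop).

Lemma in_ideal0 : in_ideal G 0.
Proof.
by exists 0%N, (fun=> 0), (fun=> 0); split=> [[]//|]; rewrite big_ord0.
Qed.

Lemma in_ideal_gen g : G g -> in_ideal G g.
Proof. by exists 1%N, (fun=> 1), (fun=> g); rewrite big_ord1 mul1r. Qed.

Lemma in_idealD f g : in_ideal G f -> in_ideal G g -> in_ideal G (f + g).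
Proof.
move=> [n [c [x [Gx ->]]]] [m [d [y [Gy ->]]]].
exists (n + m)%N, (fun i => match split i with inl i => c i | inr i => d i end).
exists (fun i => match split i with inl i => x i | inr i => y i end); split.
  by move=> i; case: split.
rewrite big_split_ord /=; congr (_ + _); apply: eq_bigr => i _.
  by rewrite -[lshift _ _]/(unsplit (inl i)) unsplitK.
by rewrite -[rshift _ _]/(unsplit (inr i)) unsplitK.
Qed.

Lemma in_idealM a f : in_ideal G f -> in_ideal G (a * f).
Proof.
move=> [n [c [x [Gx ->]]]]; exists n, (fun i => a * c i), x; split=> //.
by rewrite mulr_sumr; apply: eq_bigr => i _; rewrite mulrA.
Qed.

Lemma in_ideal_sum (I : eqType) (s : seq I) (F : I -> S) :
  {in s, forall i, in_ideal G (F i)} -> in_ideal G (\sum_(i <- s) F i).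
Proof.
move=> GF; rewrite big_seq; elim/big_ind: _ => //; first exact: in_ideal0.
exact: in_idealD.
Qed.

Lemma in_ideal_min (J : S -> Prop) f :
  J 0 -> (forall f g, J f -> J g -> J (f + g)) -> (forall a g, G g -> J (a * g)) ->
  in_ideal G f -> J f.
Proof.
move=> J0 JD JM [n [c [g [Gg ->]]]]; elim/big_ind: _ => // i _; exact: JM.
Qed.

End Ideals.

Section Characters.
Import monalg.
Variables (N : nmodType) (K : fieldType).
Local Notation alg := (monoid_alg N K).
Local Notation chr := (@character N K).
Implicit Types (p q : N) (f g : alg).

Lemma characterD p q : chr (p + q) = chr p * chr q.
Proof. by rewrite [RHS]malg_mulUU mulr1. Qed.

Lemma character0 : chr 0 = 1.
Proof. by []. Qed.

Lemma characterMn p n : chr (p *+ n) = chr p ^+ n.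
Proof.
by elim: n => [|n IH]; rewrite ?character0 // mulrS characterD IH exprS.
Qed.

Lemma character_sum (I : Type) (s : seq I) (F : I -> N) :
  chr (\sum_(i <- s) F i) = \prod_(i <- s) chr (F i).
Proof. exact: (big_morph chr characterD character0). Qed.

Lemma coefficientD p f g : coefficient p (f + g) = coefficient p f + coefficient p g.
Proof. exact: mcoeffD. Qed.

Lemma coefficientZ p c f : coefficient p (c *: f) = c * coefficient p f.
Proof. exact: mcoeffZ. Qed.

Lemma coefficient0 p : coefficient p (0 : alg) = 0.
Proof. exact: mcoeff0. Qed.

Lemma coefficientB p f g : coefficient p (f - g) = coefficient p f - coefficient p g.
Proof. exact: mcoeffB. Qed.

Lemma coefficient_sum p (I : Type) (s : seq I) (F : I -> alg) :
  coefficient p (\sum_(i <- s) F i) = \sum_(i <- s) coefficient p (F i).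
Proof. exact: (big_morph _ (coefficientD p) (coefficient0 p)). Qed.

Lemma coefficient_chr p q : coefficient q (chr p) = (p == q)%:R.
Proof. exact: mcoeffU. Qed.

Lemma character_inj : injective chr.
Proof.
move=> p q /(congr1 (coefficient p)); rewrite !coefficient_chr eqxx.
by case: eqP => // _ /eqP; rewrite oner_eq0.
Qed.

Definition support f : seq N := msupp f.

Lemma support_uniq f : uniq (support f).
Proof. exact: fset_uniq. Qed.

Lemma mem_support f p : (p \in support f) = (coefficient p f != 0).
Proof. by rewrite /coefficient mcoeff_neq0. Qed.

Lemma monoid_alg_eq f g : (forall p, coefficient p f = coefficient p g) -> f = g.
Proof. by move/malgP. Qed.

Lemma monoid_algE f : f = \sum_(p <- support f) coefficient p f *: chr p.
Proof.
apply: monoid_alg_eq => q; rewrite coefficient_sum.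
under eq_bigr do rewrite coefficientZ coefficient_chr.
have [qf|] := boolP (q \in support f).
  rewrite (big_rem q) //= eqxx mulr1 big_seq big1 ?addr0 // => p.
  by rewrite mem_rem_uniq ?support_uniq // inE => /andP[/negPf -> _]; rewrite mulr0.
move=> qf; rewrite big_seq big1; first by apply/eqP; rewrite -[_ == 0]negbK -mem_support.
by move=> p pf; case: eqP => [E|_]; rewrite ?mulr0 // -E pf in qf *.
Qed.

Lemma coefficient_mul_chr f p q : coefficient q (f * chr p) =
  \sum_(t <- support f | t + p == q) coefficient t f.
Proof.
rewrite {1}[f]monoid_algE mulr_suml coefficient_sum [RHS]big_mkcond;
  apply: eq_bigr => t _.
rewrite -scalerAl -characterD coefficientZ coefficient_chr.
by case: eqP; rewrite ?mulr1 ?mulr0.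
Qed.

(** An ideal generated by characters is a monomial ideal, so membership can be read off the
    support. *)
Lemma in_ideal_chr (S : N -> Prop) (G : alg -> Prop) f :
  (forall g, G g <-> exists2 s, S s & g = chr s) ->
  in_ideal G f <-> forall p, coefficient p f != 0 -> exists2 s, S s & exists q, p = s + q.
Proof.
move=> GS; split=> [|supp].
  pose J f := forall p, coefficient p f != 0 -> exists2 s, S s & exists q, p = s + q.
  apply: (@in_ideal_min _ _ J) => [p|g h Jg Jh p|a g /GS[s Ss ->] p].
  - by rewrite coefficient0 eqxx.
  - rewrite coefficientD => gh; have [g0|/Jg //] := eqVneq (coefficient p g) 0.
    by apply: Jh; rewrite g0 add0r in gh.
  rewrite coefficient_mul_chr => ne; exists s => //.
  have [/hasP[t _ /eqP <-]|no] := boolP (has (fun t => t + s == p) (support a)).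
    by exists t; rewrite addrC.
  by rewrite big_hasC ?eqxx in ne.
rewrite [f]monoid_algE; apply: in_ideal_sum => p;
  rewrite mem_support => /supp[s Ss [q ->]].
rewrite addrC characterD scalerAl; apply/in_idealM/in_ideal_gen/GS.
by exists s.
Qed.

End Characters.

(** * The tent and its coordinate ring *)

Section TentEvaluation.
Import mpoly.
Variables (K : fieldType) (r alpha s beta : nat).
Local Notation k := (cq_top K r alpha).
Local Notation l := (cq_top K s beta).
Local Notation mon := 'X_{1..k.+1 + l.+1}.
Local Notation genx := (@cq_gen K r alpha).
Local Notation geny := (@cq_gen K s beta).

Definition tent_exp (c : 'I_k.+1 -> nat) (d : 'I_l.+1 -> nat) : mon :=
  [multinom (match split t with inl i => c i | inr j => d j end) | t < k.+1 + l.+1].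

Lemma tent_expl c d i : tent_exp c d (lshift l.+1 i) = c i.
Proof. by rewrite mnmE -[lshift _ _]/(unsplit (inl i)) unsplitK. Qed.

Lemma tent_expr c d j : tent_exp c d (rshift k.+1 j) = d j.
Proof. by rewrite mnmE -[rshift _ _]/(unsplit (inr j)) unsplitK. Qed.

Lemma tent_expE (m : mon) :
  m = tent_exp (fun i => m (lshift l.+1 i)) (fun j => m (rshift k.+1 j)).
Proof.
apply/mnmP => t; rewrite -[t]splitK; case: (split t) => i /=.
  by rewrite tent_expl.
by rewrite tent_expr.
Qed.

Lemma prod_split (R : comPzRingType) (F : 'I_(k.+1 + l.+1) -> R) (m : mon) :
  \prod_t F t ^+ m t
    = (\prod_i F (lshift l.+1 i) ^+ m (lshift l.+1 i))
      * \prod_j F (rshift k.+1 j) ^+ m (rshift k.+1 j).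
Proof. by rewrite big_split_ord. Qed.

Lemma uv_prod (r' alpha' : nat) (n := cq_top K r' alpha') (c : 'I_n.+1 -> nat) :
  \prod_i uv K (cq_gen i) ^+ c i
    = uv K (\sum_i c i * (cq_gen i).1, \sum_i c i * (cq_gen i).2)%N.
Proof.
rewrite /uv /= !expr_sum -big_split /=; apply: eq_bigr => i _.
by rewrite exprMn -!exprM mulnC [in X in _ * X]mulnC.
Qed.

Lemma cq_ideal_binomial (r' alpha' : nat) (n := cq_top K r' alpha')
    (c c' : 'X_{1..n.+1}) :
  (\sum_i c i * (cq_gen i).1 = \sum_i c' i * (cq_gen i).1)%N ->
  (\sum_i c i * (cq_gen i).2 = \sum_i c' i * (cq_gen i).2)%N ->
  cq_ideal ('X_[c] - 'X_[c'] : {mpoly K[n.+1]}).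
Proof.
move=> E1 E2; rewrite /cq_ideal rmorphB /= !comp_mpolyX.
under eq_bigr do rewrite tnth_mktuple.
under [X in _ - X]eq_bigr do rewrite tnth_mktuple.
by rewrite !uv_prod E1 E2 subrr.
Qed.

Lemma cq_ideal_eval (r' alpha' : nat) (n := cq_top K r' alpha')
    (p : {mpoly K[n.+1]}) (a b : K) (v : 'I_n.+1 -> K) :
  cq_ideal p -> (forall i, v i = a ^+ (cq_gen i).1 * b ^+ (cq_gen i).2) -> p.@[v] = 0.
Proof.
move=> p0 Ev; pose w (i : 'I_2) := if i == ord0 then a else b.
have := congr1 (meval w) p0; rewrite comp_mpoly_meval meval0 => <-; apply: meval_eq => i.
by rewrite tnth_mktuple /uv mevalM !rmorphXn /= !mevalXU Ev.
Qed.

(** The hypotheses say that [v] is a point of the tent: its two parts are the images of [(a, b)] in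
    S_1 and of [(a', b')] in S_3, and the mixed products vanish. *)
Lemma tent_eval (v : 'I_(k.+1 + l.+1) -> K) (a b a' b' : K) p :
  (forall i, v (lshift l.+1 i) = a ^+ (genx i).1 * b ^+ (genx i).2) ->
  (forall j, v (rshift k.+1 j) = a' ^+ (geny j).1 * b' ^+ (geny j).2) ->
  (forall i j, (i, j) <> (ord0, ord0) -> (i, j) <> (ord_max, ord_max) ->
     v (lshift l.+1 i) * v (rshift k.+1 j) = 0) ->
  tent_ideal p -> p.@[v] = 0.
Proof.
move=> vx vy vxy; apply: (@in_ideal_min _ _ (fun p => p.@[v] = 0)).
- exact: meval0.
- by move=> f g; rewrite mevalD => -> ->; rewrite addr0.
move=> c g [q q0|q q0|i j ne0 ne1]; rewrite mevalM.
- rewrite comp_mpoly_meval (cq_ideal_eval (a := a) (b := b) q0) ?mulr0 // => i.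
  by rewrite tnth_mktuple mevalXU vx.
- rewrite comp_mpoly_meval (cq_ideal_eval (a := a') (b := b') q0) ?mulr0 // => i.
  by rewrite tnth_mktuple mevalXU vy.
by rewrite mevalM !mevalXU vxy ?mulr0.
Qed.

Lemma tent_monomial_x (c : 'I_k.+1 -> nat) :
  'X_[tent_exp c (fun=> 0%N)] = 'X_[[multinom c i | i < k.+1]] \mPo [tuple tent_X s
    beta i | i < k.+1] :> {mpoly K[_]}.
Proof.
rewrite comp_mpolyX mpolyXE_id prod_split [X in _ * X]big1 ?mulr1.
  by apply: eq_bigr => i _; rewrite tnth_mktuple tent_expl mnmE.
by move=> j _; rewrite tent_expr.
Qed.

Lemma tent_monomial_y (d : 'I_l.+1 -> nat) :
  'X_[tent_exp (fun=> 0%N) d] = 'X_[[multinom d i | i < l.+1]] \mPo [tuple tent_Y r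
    alpha i | i < l.+1] :> {mpoly K[_]}.
Proof.
rewrite comp_mpolyX mpolyXE_id prod_split [X in X * _]big1 ?mul1r.
  by apply: eq_bigr => i _; rewrite tnth_mktuple tent_expr mnmE.
by move=> j _; rewrite tent_expl.
Qed.

Lemma tent_binomial_x (c c' : 'I_k.+1 -> nat) :
  (\sum_i c i * (genx i).1 = \sum_i c' i * (genx i).1)%N ->
  (\sum_i c i * (genx i).2 = \sum_i c' i * (genx i).2)%N ->
  tent_ideal ('X_[tent_exp c (fun=> 0%N)] - 'X_[tent_exp c' (fun=> 0%N)] : {mpoly
    K[k.+1 + l.+1]}).
Proof.
move=> E1 E2; rewrite !tent_monomial_x -rmorphB; apply/in_ideal_gen/TentS1.
by apply: cq_ideal_binomial; under eq_bigr do rewrite mnmE;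
  under [RHS]eq_bigr do rewrite mnmE.
Qed.

Lemma tent_binomial_y (c c' : 'I_l.+1 -> nat) :
  (\sum_i c i * (geny i).1 = \sum_i c' i * (geny i).1)%N ->
  (\sum_i c i * (geny i).2 = \sum_i c' i * (geny i).2)%N ->
  tent_ideal ('X_[tent_exp (fun=> 0%N) c] - 'X_[tent_exp (fun=> 0%N) c'] : {mpoly
    K[k.+1 + l.+1]}).
Proof.
move=> E1 E2; rewrite !tent_monomial_y -rmorphB; apply/in_ideal_gen/TentS3.
by apply: cq_ideal_binomial; under eq_bigr do rewrite mnmE;
  under [RHS]eq_bigr do rewrite mnmE.
Qed.

Lemma tent_XY i j : (i, j) <> (ord0, ord0) -> (i, j) <> (ord_max, ord_max) ->
  tent_ideal ('X_(lshift l.+1 i) * 'X_(rshift k.+1 j) : {mpoly K[k.+1 + l.+1]}).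
Proof. by move=> n0 n1; apply/in_ideal_gen/TentXY. Qed.

Variable E : toric_data k l.

Definition td_exp (c : 'I_k.+1 -> nat) (d : 'I_l.+1 -> nat) : E :=
  \sum_i td_x E i *+ c i + \sum_j td_y E j *+ d j.

Definition td_mon (m : mon) : E :=
  td_exp (fun i => m (lshift l.+1 i)) (fun j => m (rshift k.+1 j)).

Lemma td_mon_exp c d : td_mon (tent_exp c d) = td_exp c d.
Proof.
rewrite /td_mon /td_exp; congr (_ + _); apply: eq_bigr => i _.
  by rewrite tent_expl.
by rewrite tent_expr.
Qed.

Lemma td_evalE p :
  td_eval E p = \sum_(m <- msupp p) p@_m *: character K (td_mon m).
Proof.
rewrite /td_eval /mmap; apply: eq_bigr => m _; rewrite /= mulr_algl; congr (_ *: _).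
rewrite /mmap1 prod_split characterD !character_sum; congr (_ * _); apply: eq_bigr => i _.
  by rewrite characterMn /td_coord -[lshift _ _]/(unsplit (inl i)) unsplitK.
by rewrite characterMn /td_coord -[rshift _ _]/(unsplit (inr i)) unsplitK.
Qed.

Lemma td_evalB : {morph td_eval E : p q / p - q}.
Proof. exact: mmapB. Qed.

Lemma td_eval0 : td_eval E 0 = 0.
Proof. exact: mmap0. Qed.

Lemma td_evalD : {morph td_eval E : p q / p + q}.
Proof. exact: mmapD. Qed.

Lemma td_evalZ c p : td_eval E (c *: p) = c *: td_eval E p.
Proof. by rewrite -[RHS]mulr_algl; apply: mmapZ. Qed.

Lemma td_evalX m : td_eval E 'X_[m] = character K (td_mon m).
Proof. by rewrite td_evalE msuppX big_seq1 mcoeffX eqxx scale1r. Qed.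

Lemma coefficient_td_eval q p :
  coefficient q (td_eval E p) = \sum_(m <- msupp p | td_mon m == q) p@_m.
Proof.
rewrite td_evalE coefficient_sum [RHS]big_mkcond; apply: eq_bigr => m _.
by rewrite coefficientZ coefficient_chr; case: eqP; rewrite ?mulr1 ?mulr0.
Qed.

Definition divAB (p : E) := exists q, p = td_A E + q \/ p = td_B E + q.

Lemma td_idealP f :
  td_ideal f <-> forall p, coefficient p (f : monoid_alg E K) != 0 -> divAB p.
Proof.
rewrite /td_ideal (in_ideal_chr (S := fun s => s = td_A E \/ s = td_B E)); last first.
  move=> g; split=> [[->|->]|[t [->|->] ->]]; [| | by left | by right].
    by exists (td_A E); [left|].
  by exists (td_B E); [right|].
split=> H p /H; first by case=> t [->|->] [q ->]; exists q; [left|right].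
by case=> q [->|->]; [exists (td_A E) | exists (td_B E)]; [left|exists q|right|exists q].
Qed.

Lemma td_ideal_chr p : td_ideal (character K p) <-> divAB p.
Proof.
rewrite td_idealP; split=> [|H q]; first by apply; rewrite coefficient_chr eqxx oner_eq0.
by rewrite coefficient_chr; case: (p =P q) => [<-|]; rewrite ?eqxx.
Qed.

End TentEvaluation.

(** * The lattice of a toric extension *)

Section IntegerRelations.
Variables (n : nat) (g : 'I_n -> nat * nat) (V : zmodType) (X : 'I_n -> V).
Hypothesis rel : forall c c' : 'I_n -> nat,
  (\sum_i c i * (g i).1 = \sum_i c' i * (g i).1)%N ->
  (\sum_i c i * (g i).2 = \sum_i c' i * (g i).2)%N ->
  \sum_i X i *+ c i = \sum_i X i *+ c' i.

(** Splitting [z] into positive and negative parts gives two families of natural exponents to which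
    [rel] applies. *)
Lemma int_relation (z : 'I_n -> int) :
  \sum_i z i * (g i).1%:Z = 0 -> \sum_i z i * (g i).2%:Z = 0 ->
  \sum_i X i *~ z i = 0.
Proof.
pose c i := if 0 <= z i then `|z i|%N else 0%N.
pose c' i := if 0 <= z i then 0%N else `|z i|%N.
have zE i : z i = (c i)%:Z - (c' i)%:Z by rewrite /c /c'; case: ifP; lia.
have sumE (F : 'I_n -> nat) : \sum_i z i * (F i)%:Z = 0 ->
    (\sum_i c i * F i = \sum_i c' i * F i)%N.
  have PoszS (G : 'I_n -> nat) : (\sum_i G i)%N%:Z = \sum_i (G i)%:Z.
    by rewrite -natz natr_sum; apply: eq_bigr => i _; rewrite natz.
  move=> E; apply/eqP; rewrite -eqz_nat !PoszS -subr_eq0 -sumrB; apply/eqP;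
    apply: etrans E.
  by apply: eq_bigr => i _; rewrite zE !PoszM mulrBl.
move=> /sumE E1 /sumE E2; have := rel E1 E2 => /eqP;
  rewrite -subr_eq0 -sumrB => /eqP H; apply: etrans H.
by apply: eq_bigr => i _; rewrite zE mulrzBr -!pmulrn.
Qed.

Lemma int_relation3 i1 i2 i3 (z1 z2 z3 : int) :
  z1 * (g i1).1%:Z + z2 * (g i2).1%:Z + z3 * (g i3).1%:Z = 0 ->
  z1 * (g i1).2%:Z + z2 * (g i2).2%:Z + z3 * (g i3).2%:Z = 0 ->
  X i1 *~ z1 + X i2 *~ z2 + X i3 *~ z3 = 0.
Proof.
(* The three indices may coincide, so their contributions are added. *)
pose z i := z1 *+ (i == i1) + z2 *+ (i == i2) + z3 *+ (i == i3).
have zE (W : zmodType) (F : 'I_n -> W) :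
    \sum_i F i *~ z i = F i1 *~ z1 + F i2 *~ z2 + F i3 *~ z3.
  have delta j (y : int) : \sum_i F i *~ (y *+ (i == j)) = F j *~ y.
    rewrite (bigD1 j) //= eqxx big1 ?addr0 // => i /negPf ->.
    by rewrite mulr0z.
  by under eq_bigr do rewrite !mulrzDr; rewrite !big_split /= !delta.
move=> E1 E2; rewrite -zE; apply: int_relation.
  by under eq_bigr do rewrite mulrC -mulrzz; rewrite zE !mulrzz ![_%:Z * _]mulrC.
by under eq_bigr do rewrite mulrC -mulrzz; rewrite zE !mulrzz ![_%:Z * _]mulrC.
Qed.

End IntegerRelations.

Section GeneratorCoordinates.
Variables (K : fieldType) (r alpha : nat).
Hypothesis prim : exists z : K, r.-primitive_root z.
Hypothesis red : reduced_form r alpha.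
Local Notation gen := (@cq_gen K r alpha).

(** The exponents [(1, c)] and [(0, r)] of x_(k-1) and x_k form a basis of the lattice of invariant
    exponents. *)
Lemma gen_subtop_coord i : exists q : int,
  (gen i).2%:Z = (gen i).1%:Z * (subtop_exp r alpha)%:Z + q * r%:Z.
Proof.
have /dvdnP[p Ep] := cq_gen_inv prim red i.
have /dvdnP[p' Ep'] := subtop_exp_dvd red.
exists (p%:Z - (gen i).1%:Z * p'%:Z).
have : (subtop_exp r alpha)%:Z = p'%:Z * r%:Z - alpha%:Z by rewrite -PoszM -Ep' PoszD;
  ring.
have : (gen i).2%:Z = p%:Z * r%:Z - alpha%:Z * (gen i).1%:Z.
  by rewrite -PoszM -Ep PoszD PoszM; ring.
by move=> -> ->; ring.
Qed.

(** At the other end of the boundary the basis is [(c, 1)], [(r, 0)], the exponents of x_t and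
    x_0. *)
Lemma gen_c1_coord t c i : gen t = (c, 1)%N -> exists m : int,
  (gen i).1%:Z = (gen i).2%:Z * c%:Z + m * r%:Z.
Proof.
move=> Et; have /dvdnP[p Ep] := cq_gen_inv prim red i.
have := cq_gen_inv prim red t; rewrite Et /= => /dvdnP[p' Ep'].
have : (r%:Z %| (gen i).1%:Z - (gen i).2%:Z * c%:Z)%Z.
  rewrite -(@Gauss_dvdzr _ alpha%:Z) ?[coprimez _ _]coprime_sym; last by case: red.
  apply/dvdzP; exists (p%:Z - (gen i).2%:Z * p'%:Z).
  rewrite mulrBr mulrBl -mulrA -!PoszM -Ep -Ep' !PoszM !PoszD !PoszM.
  ring.
by case/dvdzP=> m Em; exists m; rewrite -Em; ring.
Qed.

End GeneratorCoordinates.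

Section Extension.
Import mpoly.
Variables (K : fieldType) (r alpha s beta : nat).
Hypothesis primr : exists z : K, r.-primitive_root z.
Hypothesis prims : exists z : K, s.-primitive_root z.
Hypothesis redr : reduced_form r alpha.
Hypothesis reds : reduced_form s beta.
Local Notation k := (cq_top K r alpha).
Local Notation l := (cq_top K s beta).
Local Notation genx := (@cq_gen K r alpha).
Local Notation geny := (@cq_gen K s beta).
Variable E : toric_data k l.
Hypothesis te : toric_extension E.
Local Notation chi := (td_chi E).

Definition tent_pt (f : 'I_k.+1 -> K) (h : 'I_l.+1 -> K) (t : 'I_(k.+1 + l.+1)) : K :=
  match split t with inl i => f i | inr j => h j end.

Lemma tent_ptl f h i : tent_pt f h (lshift l.+1 i) = f i.
Proof. by rewrite /tent_pt -[lshift _ _]/(unsplit (inl i)) unsplitK. Qed.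

Lemma tent_ptr f h j : tent_pt f h (rshift k.+1 j) = h j.
Proof. by rewrite /tent_pt -[rshift _ _]/(unsplit (inr j)) unsplitK. Qed.

(** All coordinates vanish at the origin because no generator is constant; since [0 ^+ 0 = 1], this
    has to be said. *)
Lemma gen_neq0 (r' alpha' : nat) (i : 'I_(cq_top K r' alpha').+1) :
  (exists z : K, r'.-primitive_root z) -> reduced_form r' alpha' ->
  (0 : K) ^+ (cq_gen i).1 * 0 ^+ (cq_gen i).2 = 0.
Proof.
move=> pr rd; have [_] := cq_gen_nb pr rd i; rewrite [cq_gen i]surjective_pairing
  pair_neq00.
by rewrite !expr0n -natrM mulnb /=; case: (cq_gen i) => [[|?] [|?]].
Qed.

Lemma td_mon_ideal m : divAB (td_mon E m) -> tent_ideal ('X_[m] : {mpoly K[_]}).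
Proof. by rewrite -td_ideal_chr -td_evalX => /(te_tent_kernel te). Qed.

(** In a monomial ideal the difference of two distinct characters can lie only if each of them does.
    Hence a binomial relation whose terms survive on the tent holds already in the monoid. *)
Lemma td_mon_relation m m' :
  tent_ideal ('X_[m] - 'X_[m'] : {mpoly K[_]}) -> ~ tent_ideal ('X_[m] : {mpoly K[_]}) ->
  td_mon E m = td_mon E m'.
Proof.
move=> /(te_tent_kernel te); rewrite td_evalB !td_evalX => /td_idealP H nm.
case: (td_mon E m =P td_mon E m') => // /eqP ne; case: nm; apply: td_mon_ideal.
apply: H; rewrite coefficientB !coefficient_chr eqxx [td_mon E m' == _]eq_sym (negPf
  ne) subr0.
exact: oner_neq0.
Qed.

Lemma td_x_relation c c' :
  (\sum_i c i * (genx i).1 = \sum_i c' i * (genx i).1)%N ->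
  (\sum_i c i * (genx i).2 = \sum_i c' i * (genx i).2)%N ->
  \sum_i td_x E i *+ c i = \sum_i td_x E i *+ c' i.
Proof.
move=> E1 E2; have := td_mon_relation (tent_binomial_x s beta E1 E2).
rewrite !td_mon_exp /td_exp [X in _ + X]big1 // addr0 [X in _ + X]big1 // addr0; apply.
(* The image of [(1, 1)] in S_1, at the origin of S_3: every monomial in the x_i has value 1
   there. *)
pose v := tent_pt (fun=> 1) (fun=> 0).
move=> /(tent_eval (v := v) (a := 1) (b := 1) (a' := 0) (b' := 0)) ev.
have v1 : ('X_[tent_exp c (fun=> 0%N)] : {mpoly K[_]}).@[v] = 1.
  rewrite mevalX prod_split big1 ?mul1r ?big1 //.
    by move=> j _; rewrite tent_expr.
  by move=> i _; rewrite /v tent_ptl expr1n.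
have := oner_neq0 K; rewrite -v1 ev ?eqxx //.
- by move=> i; rewrite /v tent_ptl !expr1n mulr1.
- by move=> j; rewrite /v tent_ptr gen_neq0.
- by move=> i j _ _; rewrite /v tent_ptr mulr0.
Qed.

Lemma td_y_relation c c' :
  (\sum_i c i * (geny i).1 = \sum_i c' i * (geny i).1)%N ->
  (\sum_i c i * (geny i).2 = \sum_i c' i * (geny i).2)%N ->
  \sum_i td_y E i *+ c i = \sum_i td_y E i *+ c' i.
Proof.
move=> E1 E2; have := td_mon_relation (tent_binomial_y r alpha E1 E2).
rewrite !td_mon_exp /td_exp [X in X + _]big1 // add0r [X in X + _]big1 // add0r; apply.
pose v := tent_pt (fun=> 0) (fun=> 1).
move=> /(tent_eval (v := v) (a := 0) (b := 0) (a' := 1) (b' := 1)) ev.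
have v1 : ('X_[tent_exp (fun=> 0%N) c] : {mpoly K[_]}).@[v] = 1.
  rewrite mevalX prod_split big1 ?mul1r ?big1 //.
    by move=> i _; rewrite /v tent_ptr expr1n.
  by move=> j _; rewrite tent_expl.
have := oner_neq0 K; rewrite -v1 ev ?eqxx //.
- by move=> j; rewrite /v tent_ptl gen_neq0.
- by move=> i; rewrite /v tent_ptr !expr1n mulr1.
- by move=> i j _ _; rewrite /v tent_ptl mul0r.
Qed.

Lemma chi_x_relation c c' :
  (\sum_i c i * (genx i).1 = \sum_i c' i * (genx i).1)%N ->
  (\sum_i c i * (genx i).2 = \sum_i c' i * (genx i).2)%N ->
  \sum_i chi (td_x E i) *+ c i = \sum_i chi (td_x E i) *+ c' i.
Proof.
move=> E1 E2; have := congr1 chi (td_x_relation E1 E2); rewrite !raddf_sum.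
by under eq_bigr do rewrite raddfMn; under [X in _ = X]eq_bigr do rewrite raddfMn.
Qed.

Lemma chi_y_relation c c' :
  (\sum_i c i * (geny i).1 = \sum_i c' i * (geny i).1)%N ->
  (\sum_i c i * (geny i).2 = \sum_i c' i * (geny i).2)%N ->
  \sum_i chi (td_y E i) *+ c i = \sum_i chi (td_y E i) *+ c' i.
Proof.
move=> E1 E2; have := congr1 chi (td_y_relation E1 E2); rewrite !raddf_sum.
by under eq_bigr do rewrite raddfMn; under [X in _ = X]eq_bigr do rewrite raddfMn.
Qed.

Lemma chi_x_coord : exists2 a : int, (a = alpha%:Z %[mod r%:Z])%Z &
  forall i, exists2 n : int, n * r%:Z = (genx i).2%:Z + a * (genx i).1%:Z
    & chi (td_x E i) = (chi (td_A E) - td_eta E) *~ (genx i).1 + td_xi E *~ n.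
Proof.
have [ak Eak] := te_smooth_xi te; set c := subtop_exp r alpha.
have [p' Ep'] := dvdnP (subtop_exp_dvd redr).
(* In exponents x_0 is x_(k-1)^r xi^(-c), and x_(k-1) = (A/eta) xi^(a_k) then gives xi this exponent
   in x_0. Modulo [r] it is [- c], that is [alpha]. *)
exists (r%:Z * ak - c%:Z).
  apply/eqP; rewrite eqz_mod_dvd; apply/dvdzP; exists (ak - p'%:Z).
  rewrite mulrBl -PoszM -Ep' PoszD /c; ring.
move=> i; have [q Eq] := gen_subtop_coord primr redr i; rewrite -/c in Eq.
exists (q + (genx i).1%:Z * ak); first by rewrite Eq; ring.
have := @int_relation3 _ _ _ _ chi_x_relation i (inord k.-1) ord_max 1 (- (genx
  i).1%:Z) (- q).
rewrite (cq_gen_subtop primr redr) (cq_gen_top primr redr) /= -/c Eq.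
move=> /(_ ltac:(ring) ltac:(ring)); rewrite mulr1z !mulrNz -addrA -opprD => /eqP.
rewrite subr_eq0 => /eqP ->.
have -> : chi (td_x E (inord k.-1)) = chi (td_A E) - td_eta E + td_xi E *~ ak.
  by apply: (addIr (td_eta E)); rewrite Eak addrAC subrK.
by rewrite mulrzDl -mulrzA -addrA -mulrzDr [ak * _]mulrC [_ + q]addrC.
Qed.

Lemma chi_y_coord : exists2 b : int, (b = beta%:Z %[mod s%:Z])%Z &
  forall j, exists2 n : int, n * s%:Z = (geny j).2%:Z + b * (geny j).1%:Z
    & chi (td_y E j) = (chi (td_B E) - td_xi E) *~ (geny j).1 + td_eta E *~ n.
Proof.
have [ak Eak] := te_smooth_eta te; set c := subtop_exp s beta.
have [p' Ep'] := dvdnP (subtop_exp_dvd reds).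
exists (s%:Z * ak - c%:Z).
  apply/eqP; rewrite eqz_mod_dvd; apply/dvdzP; exists (ak - p'%:Z).
  rewrite mulrBl -PoszM -Ep' PoszD /c; ring.
move=> i; have [q Eq] := gen_subtop_coord prims reds i; rewrite -/c in Eq.
exists (q + (geny i).1%:Z * ak); first by rewrite Eq; ring.
have := @int_relation3 _ _ _ _ chi_y_relation i (inord l.-1) ord_max 1 (- (geny
  i).1%:Z) (- q).
rewrite (cq_gen_subtop prims reds) (cq_gen_top prims reds) /= -/c Eq.
move=> /(_ ltac:(ring) ltac:(ring)); rewrite mulr1z !mulrNz -addrA -opprD => /eqP.
rewrite subr_eq0 => /eqP ->.
have -> : chi (td_y E (inord l.-1)) = chi (td_B E) - td_xi E + td_eta E *~ ak.
  by apply: (addIr (td_xi E)); rewrite addrC Eak addrAC subrK.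
by rewrite mulrzDl -mulrzA -addrA -mulrzDr [ak * _]mulrC [_ + q]addrC.
Qed.

Lemma chi_x_c1 t c i : genx t = (c, 1)%N -> exists m : int,
  chi (td_x E i) = chi (td_x E t) *+ (genx i).2 + chi (td_x E ord0) *~ m.
Proof.
move=> Et; have [m Em] := gen_c1_coord primr redr i Et; exists m.
have := @int_relation3 _ _ _ _ chi_x_relation i t ord0 1 (- (genx i).2%:Z) (- m).
rewrite Et (cq_gen0 primr redr) /= Em => /(_ ltac:(ring) ltac:(ring)).
by rewrite mulr1z !mulrNz -addrA -opprD => /eqP; rewrite subr_eq0 => /eqP ->.
Qed.

Lemma chi_y_c1 t c i : geny t = (c, 1)%N -> exists m : int,
  chi (td_y E i) = chi (td_y E t) *+ (geny i).2 + chi (td_y E ord0) *~ m.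
Proof.
move=> Et; have [m Em] := gen_c1_coord prims reds i Et; exists m.
have := @int_relation3 _ _ _ _ chi_y_relation i t ord0 1 (- (geny i).2%:Z) (- m).
rewrite Et (cq_gen0 prims reds) /= Em => /(_ ltac:(ring) ltac:(ring)).
by rewrite mulr1z !mulrNz -addrA -opprD => /eqP; rewrite subr_eq0 => /eqP ->.
Qed.

End Extension.

Lemma mulrz_scale (V : lmodType int) (v : V) (z : int) : v *~ z = z *: v.
Proof. by rewrite -scaler_int intz. Qed.

Lemma mulrn_scale (V : lmodType int) (v : V) (n : nat) : v *+ n = n%:Z *: v.
Proof. by rewrite -mulrz_scale pmulrn. Qed.

Definition comb4 (V : lmodType int) (v1 v2 v3 v4 : V) (z1 z2 z3 z4 : int) : V :=
  z1 *: v1 + z2 *: v2 + z3 *: v3 + z4 *: v4.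

Local Notation "''e4_' i" := (delta_mx 0 i : 'rV[int]_4) (at level 8, i at level 2).

(** Four generators of Z^4 form a basis: generation provides a left inverse of the matrix of the
    [v_i], and for square matrices it is two-sided. [Q] is the change of coordinates to the standard
    basis. *)
Lemma lattice_coord (v1 v2 v3 v4 : 'rV[int]_4) :
  (forall m, exists z1 z2 z3 z4, m = comb4 v1 v2 v3 v4 z1 z2 z3 z4) ->
  exists Q : 'M[int]_4, Q \in unitmx /\
    [/\ v1 *m Q = 'e4_0, v2 *m Q = 'e4_1, v3 *m Q = 'e4_2 & v4 *m Q = 'e4_3].
Proof.
move=> gen; pose P : 'M[int]_4 := \matrix_i nth 0 [:: v1; v2; v3; v4] i.
have /fin_all_exists[u Eu] (i : 'I_4) : exists u : 'rV[int]_4, 'e4_i = u *m P.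
  have [z1 [z2 [z3 [z4 ->]]]] := gen 'e4_i; exists (\row_j nth 0 [:: z1; z2; z3; z4] j).
  rewrite mulmx_sum_row !big_ord_recl big_ord0 !rowK !mxE /= addr0 /comb4.
  by rewrite !addrA.
pose Q : 'M[int]_4 := \matrix_i u i.
have QP : Q *m P = 1%:M.
  by apply/row_matrixP => i; rewrite row_mul rowK -Eu row1.
exists Q; split; first by have [] := mulmx1_unit QP.
have PQ : P *m Q = 1%:M by apply: mulmx1C.
have R (i : 'I_4) : nth 0 [:: v1; v2; v3; v4] i *m Q = 'e4_i.
  by rewrite -[in LHS]/(nth 0 _ i) -(rowK (fun i : 'I_4 => nth 0 [:: v1; v2; v3;
    v4] i)) -row_mul PQ row1.
by split; [apply: (R 0)|apply: (R 1)|apply: (R 2)|apply: (R 3)].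
Qed.

(** The eight equations compare the coefficients at A, B, xi, eta after xi and eta are written
    through A, B, x_0, y_0 and then x_0, y_0 are substituted. *)
Lemma corner_arith (r s a b d1 d2 d3 d4 F F' G G' : int) :
  0 < r -> 0 < s -> 0 <= F -> 0 <= F' -> 0 <= G -> 0 <= G' ->
  r * F + d1 * r = 0 -> r * F' + d2 * s = 0 ->
  d1 * a - d2 * s - 1 = 0 -> d2 * b - d1 * r = 0 ->
  s * G + d3 * r = 0 -> s * G' + d4 * s = 0 ->
  d3 * a - d4 * s = 0 -> d4 * b - d3 * r - 1 = 0 ->
  [/\ r * s - a * b = 1, 0 <= a & 0 <= b].
Proof.
move=> r0 s0 F0 F'0 G0 G'0 e1 e2 e3 e4 f1 f2 f3 f4.
have rF := mulr_ge0 (ltW r0) F0; have rF' := mulr_ge0 (ltW r0) F'0.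
have sG' := mulr_ge0 (ltW s0) G'0.
have d1_le0 : d1 <= 0 by rewrite -(pmulr_lle0 d1 r0); lra.
have d2_le0 : d2 <= 0 by rewrite -(pmulr_lle0 d2 s0); lra.
have d4_le0 : d4 <= 0 by rewrite -(pmulr_lle0 d4 s0); lra.
set D := r * s - a * b.
have mul (x y z : int) : y = z -> x * y = x * z by move=> ->.
(* Cramer's rule for the [d_i]. *)
have Dd2 : D * d2 = - r by have := mul r _ _ e3; have := mul a _ _ e4; rewrite /D; lra.
have Dd1 : D * d1 = - b by have := mul b _ _ e3; have := mul s _ _ e4; rewrite /D; lra.
have Dd4 : D * d4 = - a by have := mul a _ _ f4; have := mul r _ _ f3; rewrite /D; lra.
have Dd3 : D * d3 = - s by have := mul s _ _ f4; have := mul b _ _ f3; rewrite /D; lra.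
(* The sign of the determinant is decided here: [d2 <= 0] while [D * d2 = - r] is negative. *)
have D_gt0 : 0 < D by rewrite ltNge; apply/negP => D0; have := mulr_le0 D0 d2_le0; lra.
have DD : D * (D * (d2 * d3 - d1 * d4)) = D * 1.
  transitivity ((D * d2) * (D * d3) - (D * d1) * (D * d4)); first by ring.
  by rewrite Dd1 Dd2 Dd3 Dd4 /D; ring.
have {}DD := mulfI (lt0r_neq0 D_gt0) DD.
have := mulr_ge0_le0 (ltW D_gt0) d1_le0; have := mulr_ge0_le0 (ltW D_gt0) d4_le0.
split; [|lra|lra].
(* What remains is that a positive integer dividing 1 equals 1. *)
rewrite -/D; clear -DD D_gt0; move: D (_ - _ * d4) DD D_gt0 => z y zy z_gt0.
have y_gt0 : 0 < y by rewrite -(pmulr_rgt0 y z_gt0) zy.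
have : 0 <= (z - 1) * (y - 1) by apply: mulr_ge0; lia.
by rewrite mulrBl mulrBr zy; lia.
Qed.

(** * The corner at S_0: determinant and signs of the matrix *)

Section Corner.
Import mpoly.
Variables (K : fieldType) (r alpha s beta : nat).
Hypothesis primr : exists z : K, r.-primitive_root z.
Hypothesis prims : exists z : K, s.-primitive_root z.
Hypothesis redr : reduced_form r alpha.
Hypothesis reds : reduced_form s beta.
Local Notation k := (cq_top K r alpha).
Local Notation l := (cq_top K s beta).
Local Notation genx := (@cq_gen K r alpha).
Local Notation geny := (@cq_gen K s beta).
Variable E : toric_data k l.
Hypothesis te : toric_extension E.
Local Notation chi := (td_chi E).
Local Notation A := (chi (td_A E)).
Local Notation B := (chi (td_B E)).
Local Notation xi := (td_xi E).
Local Notation eta := (td_eta E).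
Local Notation x0 := (chi (td_x E ord0)).
Local Notation y0 := (chi (td_y E ord0)).

Lemma chi_generated (C : 'rV[int]_4 -> Prop) :
  C 0 -> (forall u v, C u -> C v -> C (u + v)) ->
  C A -> C B -> (forall i, C (chi (td_x E i))) -> (forall j, C (chi (td_y E j))) ->
  forall p : E, C (chi p).
Proof.
move=> C0 CD CA CB Cx Cy p.
have CM v n : C v -> C (v *+ n) by move=> Cv; elim: n => // n IH; rewrite mulrS;
  apply: CD.
have CS (I : Type) (t : seq I) (F : I -> E) : (forall i, C (chi (F i))) ->
  C (chi (\sum_(i <- t) F i)).
  move=> CF; elim/big_ind: _ => //; first by rewrite raddf0.
  by move=> u v; rewrite raddfD; apply: CD.
have [i [j [c [d ->]]]] := te_generated te p.
rewrite 3!raddfD !raddfMn; apply: (CD); first (apply: (CD); first by apply: (CD);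
  apply: (CM)).
  by apply: CS => t; rewrite raddfMn; apply: CM.
by apply: CS => t; rewrite raddfMn; apply: CM.
Qed.

Lemma chi_basis m : exists z1 z2 z3 z4, m = comb4 A B xi eta z1 z2 z3 z4.
Proof.
pose C v := exists z1 z2 z3 z4, v = comb4 A B xi eta z1 z2 z3 z4.
have CD u v : C u -> C v -> C (u + v).
  move=> [a1 [a2 [a3 [a4 ->]]]] [b1 [b2 [b3 [b4 ->]]]].
  exists (a1 + b1), (a2 + b2), (a3 + b3), (a4 + b4).
  by apply/rowP => i; rewrite /comb4 !mxE; ring.
have CN u : C u -> C (- u).
  move=> [a1 [a2 [a3 [a4 ->]]]]; exists (- a1), (- a2), (- a3), (- a4).
  by apply/rowP => i; rewrite /comb4 !mxE; ring.
have [p [q ->]] := te_lattice te m.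
suff Cp p' : C (chi p') by apply/CD/CN.
apply: chi_generated => {p'} //.
- by exists 0, 0, 0, 0; apply/rowP => i; rewrite /comb4 !mxE; ring.
- by exists 1, 0, 0, 0; apply/rowP => i; rewrite /comb4 !mxE; ring.
- by exists 0, 1, 0, 0; apply/rowP => i; rewrite /comb4 !mxE; ring.
- move=> i; have [a _ /(_ i)[n _ ->]] := chi_x_coord primr prims redr reds te.
  exists (genx i).1%:Z, 0, n, (- (genx i).1%:Z).
  by apply/rowP => j; rewrite !mulrz_scale /comb4 !mxE; ring.
move=> i; have [b _ /(_ i)[n _ ->]] := chi_y_coord primr prims redr reds te.
exists 0, (geny i).1%:Z, (- (geny i).1%:Z), n.
by apply/rowP => j; rewrite !mulrz_scale /comb4 !mxE; ring.
Qed.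

Lemma basis_free z1 z2 z3 z4 : comb4 A B xi eta z1 z2 z3 z4 = 0 ->
  [/\ z1 = 0, z2 = 0, z3 = 0 & z4 = 0].
Proof.
have [Q [_ [EA EB Exi Eeta]]] := lattice_coord chi_basis.
move=> /(congr1 (mulmxr Q)); rewrite /comb4 /= mul0mx !mulmxDl -!scalemxAl EA EB Exi Eeta.
move=> /rowP rel; have := (rel 0, rel 1, (rel 2, rel 3)); rewrite !mxE /=.
by case=> -[] + + [+ +]; rewrite !mulr0 !mulr1 !addr0 !add0r.
Qed.

Lemma meval_tent_pt c d f h :
  ('X_[tent_exp c d] : {mpoly K[k.+1 + l.+1]}).@[tent_pt f h]
  = (\prod_i f i ^+ c i) * \prod_j h j ^+ d j.
Proof.
rewrite mevalX prod_split; congr (_ * _); apply: eq_bigr => i _.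
  by rewrite tent_ptl tent_expl.
by rewrite tent_ptr tent_expr.
Qed.

Let v : 'I_(k.+1 + l.+1) -> K := tent_pt (fun i => (i == ord0)%:R) (fun j => (j ==
  ord0)%:R).

(** The point comes from [(1, 0)] in both quotients, because only x_0 and y_0 have second exponent
    zero. *)
Lemma corner_eval p : tent_ideal p -> p.@[v] = 0.
Proof.
apply: (tent_eval (a := 1) (b := 0) (a' := 1) (b' := 0)).
- by move=> i; rewrite /v tent_ptl expr1n mul1r expr0n (cq_gen2_eq0 primr redr).
- by move=> i; rewrite /v tent_ptr expr1n mul1r expr0n (cq_gen2_eq0 prims reds).
move=> i j ne _; rewrite /v tent_ptl tent_ptr -natrM mulnb.
by case: eqP ne => [->|] //=; case: eqP => [->|].
Qed.

Lemma sum_delta (N : nmodType) n (F : 'I_n -> N) j m :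
  \sum_i F i *+ (m * (i == j)) = F j *+ m.
Proof.
rewrite (bigD1 j) //= eqxx muln1 big1 ?addr0 // => i /negPf ->.
by rewrite muln0.
Qed.

Lemma prod_delta n (c : 'I_n.+1 -> nat) :
  \prod_i ((i == ord0)%:R : K) ^+ c i = [forall i, (i != ord0) ==> (c i == 0%N)]%:R.
Proof.
have [/fintype.forallP c0|] := boolP [forall i, (i != ord0) ==> (c i == 0%N)].
  by rewrite big1 // => i _; case: eqP (c0 i) => [->|_ /eqP ->]; rewrite ?expr1n.
move=> /forallPn; case=> i; rewrite negb_imply => /andP[i0 ci].
by rewrite (bigD1 i) //= (negPf i0) expr0n (negPf ci) mul0r.
Qed.

Variables (t : 'I_k.+1) (t1 : nat) (u : 'I_l.+1) (u1 : nat).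
Hypotheses (Et : genx t = (t1, 1)%N) (Eu : geny u = (u1, 1)%N).
Local Notation xt := (chi (td_x E t)).
Local Notation yu := (chi (td_y E u)).

Let t_neq0 : t != ord0.
Proof. by rewrite -(cq_gen2_eq0 primr redr) Et. Qed.

Let u_neq0 : u != ord0.
Proof. by rewrite -(cq_gen2_eq0 prims reds) Eu. Qed.

(* Modulo the face generated by x_0 and y_0 the monoid has no units: this face
   is a stratum of the tent, seen by the evaluation v at x_0 = y_0 = 1 that
   kills the other coordinates. *)
Lemma corner_pointed (n1 n2 n3 n4 : nat) (z z' : int) :
  n1%:Z *: A + n2%:Z *: B + n3%:Z *: xt + n4%:Z *: yu + z *: x0 + z' *: y0 = 0 ->
  [/\ n1 = 0, n2 = 0, n3 = 0 & n4 = 0]%N.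
Proof.
have [zp [zn ->]] : exists zp zn : nat, z = zp%:Z - zn%:Z.
  by case: (intP z) => [|n|n]; [exists 0%N, 0%N|exists n.+1, 0%N|exists 0%N, n.+1];
    rewrite ?subr0 ?sub0r.
have [zp' [zn' ->]] : exists zp zn : nat, z' = zp%:Z - zn%:Z.
  by case: (intP z') => [|n|n]; [exists 0%N, 0%N|exists n.+1, 0%N|exists 0%N, n.+1];
    rewrite ?subr0 ?sub0r.
move=> rel.
(* Negative powers of x_0 and y_0 go to the right-hand side, which turns the lattice relation into
   an equality in the monoid. *)
pose cR i := (zn * (i == ord0 :> 'I_k.+1))%N; pose dR j :=
  (zn' * (j == ord0 :> 'I_l.+1))%N.
pose cL i := (n3 * (i == t) + zp * (i == ord0))%N.
pose dL j := (n4 * (j == u) + zp' * (j == ord0))%N.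
have relN : td_A E *+ n1 + td_B E *+ n2 + td_exp E cL dL = td_exp E cR dR.
  apply: (te_injective te); rewrite /td_exp /cL /dL /cR /dR.
  under eq_bigr do rewrite mulrnDr; under [X in _ + (_ + X)]eq_bigr do rewrite mulrnDr.
  rewrite !big_split /= !sum_delta !raddfD !raddfMn /= !mulrn_scale.
  apply/rowP => i; have /rowP/(_ i) := rel; rewrite !mxE => H.
  by apply/eqP; rewrite -subr_eq0 -[X in _ == X]H; apply/eqP; ring.
have vR : ('X_[tent_exp cR dR] : {mpoly K[_]}).@[v] = 1.
  rewrite meval_tent_pt !prod_delta.
  have -> : [forall i, (i != ord0) ==> (cR i == 0%N)].
    by apply/forallP => i; apply/implyP => /negPf ne; rewrite /cR ne muln0.
  have -> : [forall i, (i != ord0) ==> (dR i == 0%N)].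
    by apply/forallP => i; apply/implyP => /negPf ne; rewrite /dR ne muln0.
  by rewrite mulr1.
(* The right-hand side is nonzero at [v], hence divisible neither by A nor by B; this rules out A
   and B on the left. *)
have notdiv : ~ divAB (td_exp E cR dR).
  rewrite -td_mon_exp => /(td_mon_ideal te)/corner_eval/eqP.
  by rewrite vR oner_eq0.
have n1_0 : n1 = 0%N.
  case: n1 relN {rel} => // n1 relN; case: notdiv; rewrite -relN mulrS -!addrA.
  by eexists; left.
have n2_0 : n2 = 0%N.
  case: n2 relN {rel} => // n2 relN; case: notdiv;
    rewrite -relN n1_0 mulr0n add0r mulrS -!addrA.
  by eexists; right.
rewrite n1_0 n2_0 !mulr0n !add0r in relN *.
(* Both sides are now monomials in the coordinates with the same character, so they agree at [v];
   there x_t and y_u vanish and cannot occur. *)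
have : tent_ideal ('X_[tent_exp cL dL] - 'X_[tent_exp cR dR] : {mpoly K[_]}).
  apply/(te_tent_kernel te); rewrite td_evalB !td_evalX !td_mon_exp relN subrr.
  exact: in_ideal0.
move/corner_eval; rewrite mevalB vR => /eqP; rewrite subr_eq0 meval_tent_pt !prod_delta.
rewrite -natrM mulnb; case: andP => [[/forallP/(_ t) c0 /forallP/(_ u) d0] _|_];
  last first.
  by rewrite eq_sym oner_eq0.
move: c0 d0; rewrite t_neq0 u_neq0 /cL /dL !eqxx (negPf t_neq0) (negPf u_neq0) /=
  !muln0 !muln1 !addn0.
by move=> /eqP -> /eqP ->.
Qed.

(** The exponents of x_0 and y_0 may be any integers: this is a statement about [w] modulo the group
    generated by x_0 and y_0. *)
Definition corner (w : 'rV[int]_4) (n1 n2 n3 n4 : nat) := exists z z' : int,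
  w = n1%:Z *: A + n2%:Z *: B + n3%:Z *: xt + n4%:Z *: yu + z *: x0 + z' *: y0.

Lemma corner_form p : exists n1 n2 n3 n4, corner (chi p) n1 n2 n3 n4.
Proof.
move: p; apply: (@chi_generated (fun w => exists n1 n2 n3 n4, corner w n1 n2 n3 n4)).
- by exists 0%N, 0%N, 0%N, 0%N, 0, 0; apply/rowP => i; rewrite !mxE; ring.
- move=> w w' [a1 [a2 [a3 [a4 [a5 [a6 ->]]]]]] [b1 [b2 [b3 [b4 [b5 [b6 ->]]]]]].
  exists (a1 + b1)%N, (a2 + b2)%N, (a3 + b3)%N, (a4 + b4)%N, (a5 + b5), (a6 + b6).
  by apply/rowP => i; rewrite !mxE !PoszD; ring.
- by exists 1%N, 0%N, 0%N, 0%N, 0, 0; apply/rowP => i; rewrite !mxE; ring.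
- by exists 0%N, 1%N, 0%N, 0%N, 0, 0; apply/rowP => i; rewrite !mxE; ring.
- move=> i; have [m ->] := chi_x_c1 primr prims redr reds te i Et.
  exists 0%N, 0%N, (genx i).2, 0%N, m, 0.
  by apply/rowP => j; rewrite mulrz_scale mulrn_scale !mxE; ring.
move=> i; have [m ->] := chi_y_c1 primr prims redr reds te i Eu.
exists 0%N, 0%N, 0%N, (geny i).2, 0, m.
by apply/rowP => j; rewrite mulrz_scale mulrn_scale !mxE; ring.
Qed.

Lemma td_eval_XY i j : td_eval E ('X_(lshift l.+1 i) * 'X_(rshift k.+1 j))
  = character K (td_x E i + td_y E j).
Proof.
rewrite /td_eval rmorphM /= !mmapX !mmap1U /td_coord characterD.
by rewrite -[lshift _ _]/(unsplit (inl i)) -[rshift _ _]/(unsplit (inr j)) !unsplitK.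
Qed.

Lemma divAB_XY i j : (i, j) <> (ord0, ord0) -> (i, j) <> (ord_max, ord_max) ->
  divAB (td_x E i + td_y E j).
Proof.
by move=> n0 n1; apply/td_ideal_chr; rewrite -td_eval_XY;
  apply/(te_tent_kernel te)/tent_XY.
Qed.

Lemma corner_divAB p w (z z' : int) : divAB p -> chi p = w + z *: x0 + z' *: y0 ->
  exists n1 n2 n3 n4, (0 < n1 + n2)%N /\ corner w n1 n2 n3 n4.
Proof.
move=> [q pq] Ew; have [m1 [m2 [m3 [m4 [y [y' Eq]]]]]] := corner_form q.
have -> : w = chi p - z *: x0 - z' *: y0 by rewrite Ew; apply/rowP => i; rewrite !mxE;
  ring.
case: pq => ->; rewrite raddfD Eq /=.
  exists m1.+1, m2, m3, m4; split=> //; exists (y - z), (y' - z').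
  by apply/rowP => i; rewrite !mxE !intS; ring.
exists m1, m2.+1, m3, m4; split=> //; first by rewrite addnS.
exists (y - z), (y' - z').
by apply/rowP => i; rewrite !mxE !intS; ring.
Qed.

Lemma corner_xt : exists n1 n2 n4, (0 < n1 + n2)%N /\ corner xt n1 n2 0 n4.
Proof.
have [||n1 [n2 [n3 [n4 [pos [z [z' rel]]]]]]] :=
  @corner_divAB (td_x E t + td_y E ord0) xt 0 1.
- apply: divAB_XY; first by case=> E0; move: t_neq0; rewrite E0 eqxx.
  by move=> /(congr1 (fun p => val p.2)) /=; have := cq_top_gt0 prims reds; lia.
- by rewrite raddfD; apply/rowP => i; rewrite !mxE; ring.
(* If x_t occurred on the right, cancelling it would leave a trivial class with a factor A or B,
   against pointedness. *)
exists n1, n2, n4; split=> //; case: n3 rel => [|n3] rel; first by exists z, z'.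
have [|n10 n20 _ _] := @corner_pointed n1 n2 n3 n4 z z'; last by move: pos;
  rewrite n10 n20.
by apply/rowP => i; have /rowP/(_ i) := rel; rewrite !mxE intS => H; lra.
Qed.

Lemma corner_yu : exists n1 n2 n3, (0 < n1 + n2)%N /\ corner yu n1 n2 n3 0.
Proof.
have [||n1 [n2 [n3 [n4 [pos [z [z' rel]]]]]]] :=
  @corner_divAB (td_x E ord0 + td_y E u) yu 1 0.
- apply: divAB_XY; first by case=> E0; move: u_neq0; rewrite E0 eqxx.
  by move=> /(congr1 (fun p => val p.1)) /=; have := cq_top_gt0 primr redr; lia.
- by rewrite raddfD; apply/rowP => i; rewrite !mxE; ring.
exists n1, n2, n3; split=> //; case: n4 rel => [|n4] rel; first by exists z, z'.
have [|n10 n20 _ _] := @corner_pointed n1 n2 n3 n4 z z'; last by move: pos;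
  rewrite n10 n20.
by apply/rowP => i; have /rowP/(_ i) := rel; rewrite !mxE intS => H; lra.
Qed.

(* Since x_t y_0 = 0 and x_0 y_u = 0 on the tent, modulo x_0 and y_0 each of
   x_t and y_u is A or B times a monomial in A, B, x_t, y_u; pointedness
   leaves only monomials in A and B. *)
Lemma corner_smooth :
  (exists n1 n2, corner xt n1 n2 0 0) /\ (exists n1 n2, corner yu n1 n2 0 0).
Proof.
have [n1 [n2 [n4 [pos [z [z' rel]]]]]] := corner_xt.
have [m1 [m2 [m3 [pos' [y [y' rel']]]]]] := corner_yu.
have [n40|n4_gt0] := posnP n4.
  rewrite n40 in rel; split; first by exists n1, n2, z, z'.
  exists (m1 + m3 * n1)%N, (m2 + m3 * n2)%N, (y + m3%:Z * z), (y' + m3%:Z * z').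
  rewrite rel' {1}rel; apply/rowP => i; rewrite !mxE !PoszD !PoszM; ring.
have [m30|m3_gt0] := posnP m3.
  rewrite m30 in rel'; split; last by exists m1, m2, y, y'.
  exists (n1 + n4 * m1)%N, (n2 + n4 * m2)%N, (z + n4%:Z * y), (z' + n4%:Z * y').
  rewrite rel {1}rel'; apply/rowP => i; rewrite !mxE !PoszD !PoszM; ring.
(* When x_t involves y_u and y_u involves x_t, substitution writes x_t with the factor x_t^(n4 m3);
   cancelling one x_t explains the predecessor. *)
have [|] := @corner_pointed (n1 + n4 * m1) (n2 + n4 * m2) (n4 * m3).-1 0 (z + n4%:Z *
  y) (z' + n4%:Z * y').
  have -> : (n4 * m3).-1%:Z = n4%:Z * m3%:Z - 1 by nia.
  apply/rowP => i; have /rowP/(_ i) := rel; have /rowP/(_ i) := rel'.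
  rewrite !mxE !PoszD !PoszM => /(congr1 (fun c => n4%:Z * c)) /= H1 H2; lra.
by lia.
Qed.

(* The matrix of the d_i expresses xi and eta through x_0 and y_0 modulo A and B,
   so it is the inverse of ((a, -r), (-s, b)); it has entries <= 0 because A and
   B occur in xi and eta with exponents >= 0 modulo x_0 and y_0. *)
Lemma corner_det (a b : int) :
  x0 = (A - eta) *~ r + xi *~ a -> y0 = eta *~ b + (B - xi) *~ s ->
  [/\ r%:Z * s%:Z - a * b = 1, 0 <= a & 0 <= b].
Proof.
move=> Ex Ey; have [[F [F' [c1 [c2 Ext]]]] [G [G' [c3 [c4 Eyu]]]]] := corner_smooth.
have [m Exi] := chi_x_c1 primr prims redr reds te ord_max Et.
have [m' Eeta] := chi_y_c1 primr prims redr reds te ord_max Eu.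
rewrite (cq_gen_top primr redr) (cq_gen_top prims reds) /= in Exi Eeta.
(* The second exponent of xi is [r], so xi is x_t^r times a power of x_0; this produces the factor
   [r] before [F] and [F']. *)
have [d1 [d2 Cxi]] : exists d1 d2 : int,
    xi = (r%:Z * F%:Z) *: A + (r%:Z * F'%:Z) *: B + d1 *: x0 + d2 *: y0.
  exists (r%:Z * c1 + m), (r%:Z * c2); rewrite /td_xi Exi Ext mulrn_scale mulrz_scale.
  by apply/rowP => i; rewrite !mxE; ring.
have [d3 [d4 Ceta]] : exists d3 d4 : int,
    eta = (s%:Z * G%:Z) *: A + (s%:Z * G'%:Z) *: B + d3 *: x0 + d4 *: y0.
  exists (s%:Z * c3), (s%:Z * c4 + m'); rewrite /td_eta Eeta Eyu mulrn_scale mulrz_scale.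
  by apply/rowP => i; rewrite !mxE; ring.
rewrite !mulrz_scale in Ex Ey.
have [|e1 e2 e3 e4] := @basis_free (r%:Z * F%:Z + d1 * r%:Z)
    (r%:Z * F'%:Z + d2 * s%:Z) (d1 * a - d2 * s%:Z - 1) (d2 * b - d1 * r%:Z).
  apply: etrans (subrr xi); rewrite [X in _ = X - _]Cxi Ex Ey.
  by apply/rowP => i; rewrite /comb4 !mxE; ring.
have [|f1 f2 f3 f4] := @basis_free (s%:Z * G%:Z + d3 * r%:Z)
    (s%:Z * G'%:Z + d4 * s%:Z) (d3 * a - d4 * s%:Z) (d4 * b - d3 * r%:Z - 1).
  apply: etrans (subrr eta); rewrite [X in _ = X - _]Ceta Ex Ey.
  by apply/rowP => i; rewrite /comb4 !mxE; ring.
have r_gt0 : 0 < r%:Z by case: redr.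
have s_gt0 : 0 < s%:Z by case: reds.
exact: (@corner_arith r%:Z s%:Z a b d1 d2 d3 d4 F%:Z F'%:Z G%:Z G'%:Z).
Qed.

End Corner.

(** * Classification of toric extensions by matrices *)

Lemma ord2P (i : 'I_2) : i = 0 \/ i = 1.
Proof. by case: i => [[|[|//]] lt]; [left|right]; apply/val_inj. Qed.

Definition mat2 (a b c d : int) : 'M[int]_2 :=
  \matrix_(i, j) if i == 0 then (if j == 0 then a else b) else (if j == 0 then c else d).

Lemma mat2_eq (M N : 'M[int]_2) :
  M 0 0 = N 0 0 -> M 0 1 = N 0 1 -> M 1 0 = N 1 0 -> M 1 1 = N 1 1 -> M = N.
Proof.
move=> e1 e2 e3 e4; apply/matrixP => i j.
by have [->|->] := ord2P i; have [->|->] := ord2P j.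
Qed.

Lemma det_mat2 (M : 'M[int]_2) : \det M = M 0 0 * M 1 1 - M 0 1 * M 1 0.
Proof.
rewrite (expand_det_row M 0) !big_ord_recl big_ord0 /cofactor !det_mx11 !mxE /= addr0.
rewrite !expr1 expr0 mul1r mulN1r mulrN.
by congr (M _ _ * M _ _ - M _ _ * M _ _); apply/val_inj.
Qed.

Section AlgebraIso.
Variables (K : fieldType) (N N' : nmodType).

(** Because [h] has an inverse, the coefficient of the image at [q] is that of [f] at [h' q];
    linearity and bijectivity are then checked coefficientwise. *)
Lemma monoid_alg_iso (h : N -> N') (h' : N' -> N) :
  h 0 = 0 -> {morph h : p q / p + q} -> cancel h h' -> cancel h' h ->
  exists g : {lrmorphism monoid_alg N K -> monoid_alg N' K},
    bijective g /\ forall p, g (character K p) = character K (h p).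
Proof.
pose map (A B : nmodType) (u : A -> B) (f : monoid_alg A K) : monoid_alg B K :=
  \sum_(p <- support f) coefficient p f *: character K (u p).
have mapE (A B : nmodType) (u : A -> B) u' f q : cancel u u' -> cancel u' u ->
    coefficient q (map A B u f) = coefficient (u' q) f.
  move=> uK u'K; rewrite coefficient_sum [in RHS](monoid_algE f) coefficient_sum.
  apply: eq_bigr => p _; rewrite !coefficientZ !coefficient_chr; congr (_ * _%:R).
  by rewrite -(can_eq u'K) uK.
move=> h0 hD hK h'K; pose g := map N N' h.
have gE f q : coefficient q (g f) = coefficient (h' q) f by apply: mapE.
have gchr p : g (character K p) = character K (h p).
  apply: monoid_alg_eq => q; rewrite gE !coefficient_chr; congr (_%:R).
  by rewrite -(can_eq hK) h'K.
have gL : linear g.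
  move=> c f f'; apply: monoid_alg_eq => q.
  by rewrite !(gE, coefficientD, coefficientZ).
have gZ : scalable g by move=> c f; apply: monoid_alg_eq => q;
  rewrite !(gE, coefficientZ).
have gD : additive g by move=> f f'; apply: monoid_alg_eq => q;
  rewrite !(gE, coefficientB).
have gsum (I : Type) (s : seq I) F : g (\sum_(i <- s) F i) = \sum_(i <- s) g (F i).
  pose ga : {additive _ -> _} := HB.pack g (GRing.isZmodMorphism.Build _ _ g gD).
  exact: (raddf_sum ga).
have gM : monoid_morphism g.
  split=> [|f f']; first by rewrite -[in RHS]character0 -h0 -gchr.
  rewrite [f]monoid_algE [f']monoid_algE big_distrlr /= !gsum.
  rewrite big_distrlr /=; apply: eq_bigr => p _; rewrite gsum; apply: eq_bigr => q _.
  by rewrite -scalerAl -scalerAr !gZ -characterD !gchr hD characterD -scalerAl -scalerAr.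
pose gl : {lrmorphism monoid_alg N K -> monoid_alg N' K} :=
  HB.pack g (GRing.isZmodMorphism.Build _ _ g gD) (GRing.isMonoidMorphism.Build _ _ g gM)
    (GRing.isScalable.Build _ _ _ _ g gZ).
exists gl; split; last exact: gchr.
exists (map N' N h') => f; apply: monoid_alg_eq => q.
  by rewrite (mapE _ _ h' h) // gE hK.
by rewrite gE (mapE _ _ h' h) // h'K.
Qed.
End AlgebraIso.

Section Classification.
Variables (K : fieldType) (r alpha s beta : nat).
Hypothesis primr : exists z : K, r.-primitive_root z.
Hypothesis prims : exists z : K, s.-primitive_root z.
Hypothesis redr : reduced_form r alpha.
Hypothesis reds : reduced_form s beta.
Local Notation k := (cq_top K r alpha).
Local Notation l := (cq_top K s beta).
Local Notation genx := (@cq_gen K r alpha).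
Local Notation geny := (@cq_gen K s beta).
Local Notation data := (toric_data k l).

Let r_gt0 : (0 < r)%N. Proof. by case: redr. Qed.
Let s_gt0 : (0 < s)%N. Proof. by case: reds. Qed.

Lemma extension_matrix_ex (E : data) : toric_extension E -> exists a b : int,
  [/\ (a = alpha%:Z %[mod r%:Z])%Z, (b = beta%:Z %[mod s%:Z])%Z,
      extension_matrix E (mat2 r a b s),
      forall i, exists2 n : int, n * r%:Z = (genx i).2%:Z + a * (genx i).1%:Z
        & td_chi E (td_x E i) = (td_chi E (td_A E) - td_eta E) *~ (genx i).1 + td_xi E
          *~ n
    & forall j, exists2 n : int, n * s%:Z = (geny j).2%:Z + b * (geny j).1%:Z
        & td_chi E (td_y E j) = (td_chi E (td_B E) - td_xi E) *~ (geny j).1 + td_eta E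
          *~ n].
Proof.
move=> te; have [a amod xE] := chi_x_coord primr prims redr reds te.
have [b bmod yE] := chi_y_coord primr prims redr reds te.
exists a, b; split=> //; split; rewrite ?mxE //=.
  have [n En ->] := xE ord0; rewrite (cq_gen0 primr redr) /= in En *.
  by rewrite add0r in En; rewrite (mulIf _ En) // -lt0n.
have [n En ->] := yE ord0; rewrite (cq_gen0 prims reds) /= in En *.
by rewrite add0r in En; rewrite (mulIf _ En) 1?addrC // -lt0n.
Qed.

Lemma extension_matrix_inj (E : data) M M' : toric_extension E ->
  extension_matrix E M -> extension_matrix E M' -> M = M'.
Proof.
move=> te [M00 M11 Mx My] [M'00 M'11 M'x M'y].
have free := basis_free primr prims redr reds te.
apply: mat2_eq; rewrite ?M00 ?M11 //.
  move: M'x; rewrite Mx M00 M'00 => /addrI /eqP.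
  rewrite -subr_eq0 -mulrzBr mulrz_scale => /eqP rel.
  have [|_ _ /eqP] := free 0 0 (M 0 1 - M' 0 1) 0; last by rewrite subr_eq0 => /eqP.
  by rewrite /comb4 !scale0r !add0r addr0.
move: M'y; rewrite My M11 M'11 => /addIr /eqP.
rewrite -subr_eq0 -mulrzBr mulrz_scale => /eqP rel.
have [|_ _ _ /eqP] := free 0 0 0 (M 1 0 - M' 1 0); last by rewrite subr_eq0 => /eqP.
by rewrite /comb4 !scale0r !add0r.
Qed.

Lemma extension_matrix_admissible (E : data) M : toric_extension E ->
  extension_matrix E M -> admissible_matrix r alpha s beta M.
Proof.
move=> te EM; have [a [b [amod bmod Eab _ _]]] := extension_matrix_ex te.
have {M EM} -> := extension_matrix_inj te EM Eab.
have [c ncx] := newton_boundary_c1 primr redr; have [t Et] := cq_gen_ex primr redr ncx.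
have [d ncy] := newton_boundary_c1 prims reds; have [u Eu] := cq_gen_ex prims reds ncy.
have [_ _ Ex Ey] := Eab; rewrite !mxE /= in Ex Ey.
have [det a0 b0] := corner_det primr prims redr reds te Et Eu Ex Ey.
by split; rewrite ?det_mat2 ?mxE.
Qed.

(** When A, B, xi, eta are taken to the standard basis by [Q] and [Q'], corresponding generators get
    equal coordinates, since those depend only on the matrix. Both monoids thus become the same
    submonoid of Z^4. *)
Lemma extension_iso (E E' : data) M : toric_extension E -> toric_extension E' ->
  extension_matrix E M -> extension_matrix E' M -> toric_extension_iso E E'.
Proof.
move=> te te' EM EM'.
have [a [b [_ _ Eab xE yE]]] := extension_matrix_ex te.
have [a' [b' [_ _ Eab' xE' yE']]] := extension_matrix_ex te'.
have Eq := extension_matrix_inj te Eab EM; rewrite -(extension_matrix_inj te' Eab' EM')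
  in Eq.
have Ea : a = a' by have := congr1 (fun M : 'M_2 => M 0 1) Eq; rewrite !mxE.
have Eb : b = b' by have := congr1 (fun M : 'M_2 => M 1 0) Eq; rewrite !mxE.
subst a' b'.
have [Q [uQ [QA QB Qxi Qeta]]] := lattice_coord (chi_basis primr prims redr reds te).
have [Q' [uQ' [QA' QB' Qxi' Qeta']]] := lattice_coord (chi_basis primr prims redr reds
  te').
have Qx i : td_chi E (td_x E i) *m Q = td_chi E' (td_x E' i) *m Q'.
  have [n En ->] := xE i; have [n' En' ->] := xE' i.
  have -> : n' = n by apply: (@mulIf _ r%:Z); rewrite ?En ?En' // -lt0n.
  rewrite !mulmxDl !mulrz_scale -!scalemxAl !mulmxBl.
  by rewrite QA QA' Qxi Qxi' Qeta Qeta'.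
have Qy j : td_chi E (td_y E j) *m Q = td_chi E' (td_y E' j) *m Q'.
  have [n En ->] := yE j; have [n' En' ->] := yE' j.
  have -> : n' = n by apply: (@mulIf _ s%:Z); rewrite ?En ?En' // -lt0n.
  rewrite !mulmxDl !mulrz_scale -!scalemxAl !mulmxBl.
  by rewrite QB QB' Qxi Qxi' Qeta Qeta'.
have [h hE] : exists h : E -> E', forall p, td_chi E p *m Q = td_chi E' (h p) *m Q'.
  suff: forall p, exists p', td_chi E p *m Q = td_chi E' p' *m Q'
    by move=> /boolp.choice[f Ef]; exists f.
  move=> p.
  move: p; apply: (chi_generated te (C := fun w => exists p', w *m Q = td_chi E' p' *m
    Q')).
  - by exists 0; rewrite raddf0 !mul0mx.
  - by move=> w w' [p Ep] [p' Ep']; exists (p + p'); rewrite raddfD !mulmxDl Ep Ep'.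
  - by exists (td_A E'); rewrite QA QA'.
  - by exists (td_B E'); rewrite QB QB'.
  - by move=> i; exists (td_x E' i).
  by move=> j; exists (td_y E' j).
have [h' hE'] : exists h' : E' -> E, forall p, td_chi E' p *m Q' = td_chi E (h' p) *m Q.
  suff: forall p, exists p', td_chi E' p *m Q' = td_chi E p' *m Q
    by move=> /boolp.choice[f Ef]; exists f.
  move=> p.
  move: p; apply: (chi_generated te' (C := fun w => exists p', w *m Q' = td_chi E p' *m
    Q)).
  - by exists 0; rewrite raddf0 !mul0mx.
  - by move=> w w' [p Ep] [p' Ep']; exists (p + p'); rewrite raddfD !mulmxDl Ep Ep'.
  - by exists (td_A E); rewrite QA QA'.
  - by exists (td_B E); rewrite QB QB'.
  - by move=> i; exists (td_x E i).
  by move=> j; exists (td_y E j).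
have inj p q : td_chi E p *m Q = td_chi E q *m Q -> p = q.
  by move=> /(can_inj (mulmxK uQ))/(te_injective te).
have inj' p q : td_chi E' p *m Q' = td_chi E' q *m Q' -> p = q.
  by move=> /(can_inj (mulmxK uQ'))/(te_injective te').
have [|||| g [gbij gE]] := @monoid_alg_iso K E E' h h'.
- by apply: inj'; rewrite -hE !raddf0 !mul0mx.
- by move=> p q; apply: inj'; rewrite -hE !raddfD !mulmxDl !hE.
- by move=> p; apply: inj; rewrite -hE' -hE.
- by move=> p; apply: inj'; rewrite -hE -hE'.
exists g; split=> // [||i|j]; rewrite gE; congr character; apply: inj'; rewrite -hE.
- by rewrite QA QA'.
- by rewrite QB QB'.
- exact: Qx.
exact: Qy.
Qed.

(** An isomorphism of coordinate rings transports only equalities in the monoid, whereas the matrix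
    relations have negative exponents. As the entries of [M] are nonnegative, they can be written as
    x_0 eta^r = A^r xi^a and y_0 xi^s = B^s eta^b. *)
Lemma extension_iso_matrix (E E' : data) M : toric_extension E -> toric_extension E' ->
  extension_matrix E M -> toric_extension_iso E E' -> extension_matrix E' M.
Proof.
move=> te te' EM [g [_ gA gB gx gy]].
have [_ _ [] + + _ _] := extension_matrix_admissible te EM.
have [M00 M11 Ex Ey] := EM; rewrite M00 M11 in Ex Ey.
case EM01: (M 0 1) Ex => [a|//] Ex _; case EM10: (M 1 0) Ey => [b|//] Ey _.
have inj p q : td_chi E p = td_chi E q -> p = q := @te_injective _ _ _ _ _ _ te p q.
have Nx : td_x E ord0 + td_y E ord_max *+ r = td_A E *+ r + td_x E ord_max *+ a.
  apply: inj; rewrite !raddfD !raddfMn Ex /= mulrzBl -!pmulrn.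
  by rewrite addrAC subrK.
have Ny : td_y E ord0 + td_x E ord_max *+ s = td_B E *+ s + td_y E ord_max *+ b.
  apply: inj; rewrite !raddfD !raddfMn Ey /= mulrzBl -!pmulrn.
  by rewrite -addrA subrK addrC.
have Nx' : td_x E' ord0 + td_y E' ord_max *+ r = td_A E' *+ r + td_x E' ord_max *+ a.
  apply: (@character_inj _ K); have := congr1 (fun p => g (character K p)) Nx.
  by rewrite !characterD !characterMn !rmorphM !rmorphXn /= gA !gx gy.
have Ny' : td_y E' ord0 + td_x E' ord_max *+ s = td_B E' *+ s + td_y E' ord_max *+ b.
  apply: (@character_inj _ K); have := congr1 (fun p => g (character K p)) Ny.
  by rewrite !characterD !characterMn !rmorphM !rmorphXn /= gB !gy gx.
split; rewrite ?M00 ?M11 ?EM01 ?EM10 //.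
  apply: (addIr (td_chi E' (td_y E' ord_max *+ r)));
    rewrite -raddfD Nx' !raddfD !raddfMn /=.
  by rewrite mulrzBl -!pmulrn addrAC subrK.
apply: (addIr (td_chi E' (td_x E' ord_max *+ s)));
  rewrite -raddfD Ny' !raddfD !raddfMn /=.
by rewrite mulrzBl -!pmulrn -addrA subrK addrC.
Qed.

End Classification.

(** * Solutions of rs - ab = 1 with prescribed residues *)

Section Arithmetic.
Variables (r alpha s beta : nat).
Hypothesis redr : reduced_form r alpha.
Hypothesis reds : reduced_form s beta.

Lemma admissible_matrix_entries (M : 'M[int]_2) : (r, s) <> (1%N, 1%N) ->
  admissible_matrix r alpha s beta M ->
  [/\ M 0 1 = alpha%:Z, (alpha %| r * s - 1)%N
    & M 1 0 = ((r * s - 1) %/ alpha)%N%:Z] \/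
  [/\ M 1 0 = beta%:Z, (beta %| r * s - 1)%N
    & M 0 1 = ((r * s - 1) %/ beta)%N%:Z].
Proof.
move=> rs1 [[M00 M11] det [] + + amod bmod].
rewrite det_mat2 M00 M11 in det.
case: (M 0 1) det amod => [a|//] det amod _; case: (M 1 0) det bmod => [b|//] det bmod _.
have {}det : (r * s = a * b + 1)%N by lia.
have det' : (r * s - 1 = a * b)%N by rewrite det addn1 subn1.
have {}amod : a = alpha %[mod r] by move: amod; rewrite !modz_nat => -[].
have {}bmod : b = beta %[mod s] by move: bmod; rewrite !modz_nat => -[].
have [r0 _ ra] := redr; have [s0 _ sb] := reds.
have rs : r != 1%N \/ s != 1%N.
  by have [r1|] := eqVneq r 1%N; [right; apply/eqP => s1; apply: rs1; rewrite r1 s1|left].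
(* Outside [r = s = 1] the product [a * b = r * s - 1] is positive. This justifies the divisions and
   excludes [a < r] when [r = 1], and [b < s] when [s = 1]. *)
have ab0 : (0 < a)%N /\ (0 < b)%N.
  have : (0 < a * b)%N by rewrite -det'; case: rs => ?; nia.
  by rewrite muln_gt0 => /andP.
have [ar|ar] := ltnP a r.
  left; have Ea : a = alpha.
    rewrite (modn_small ar) in amod; move: ra; case: eqP => [r1 _|_ /andP[_ lt]].
      by move: ar ab0; rewrite r1; lia.
    by rewrite amod modn_small.
  by rewrite -Ea det' dvdn_mulr // mulKn //; case: ab0.
right; have bs : (b < s)%N by rewrite ltnNge; apply/negP => sb';
  have := leq_mul ar sb'; lia.
have Eb : b = beta.
  rewrite (modn_small bs) in bmod; move: sb; case: eqP => [s1 _|_ /andP[_ lt]].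
    by move: bs ab0; rewrite s1; lia.
  by rewrite bmod modn_small.
by rewrite -Eb det' dvdn_mull // mulnK //; case: ab0.
Qed.

Lemma admissible_matrix_finite : (r, s) <> (1%N, 1%N) ->
  exists sols : seq 'M[int]_2, [/\ uniq sols, (size sols <= 2)%N &
    forall M : 'M[int]_2, M \in sols <-> admissible_matrix r alpha s beta M].
Proof.
move=> rs1; pose cand := [:: mat2 r alpha ((r * s - 1) %/ alpha)%N s;
                             mat2 r ((r * s - 1) %/ beta)%N beta s].
exists (undup [seq M <- cand | `[< admissible_matrix r alpha s beta M >]]).
split; first exact: undup_uniq.
  by rewrite (leq_trans (size_undup _)) // size_filter (leq_trans (count_size _ _)).
move=> M; rewrite mem_undup mem_filter; split=> [/andP[/asboolP] //|adm].
rewrite asboolT //= !inE; have [[M00 M11] _ _ _ _] := adm.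
by case: (admissible_matrix_entries rs1 adm) => -[e1 _ e2]; apply/orP; [left|right];
  apply/eqP/mat2_eq; rewrite mxE.
Qed.

End Arithmetic.

(** * Construction of the extension from a matrix *)

Definition row4 (z1 z2 z3 z4 : int) : 'rV[int]_4 := \row_j nth 0 [:: z1; z2; z3; z4] j.

Lemma row4E z1 z2 z3 z4 : [/\ row4 z1 z2 z3 z4 0 0 = z1, row4 z1 z2 z3 z4 0 1 = z2,
  row4 z1 z2 z3 z4 0 2 = z3 & row4 z1 z2 z3 z4 0 3 = z4].
Proof. by split; rewrite mxE. Qed.

Lemma row4_eq (v w : 'rV[int]_4) :
  v 0 0 = w 0 0 -> v 0 1 = w 0 1 -> v 0 2 = w 0 2 -> v 0 3 = w 0 3 -> v = w.
Proof.
move=> e0 e1 e2 e3; apply/rowP => -[[|[|[|[|//]]]] lt].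
- by rewrite (_ : Ordinal lt = 0) //; apply/val_inj.
- by rewrite (_ : Ordinal lt = 1) //; apply/val_inj.
- by rewrite (_ : Ordinal lt = 2) //; apply/val_inj.
by rewrite (_ : Ordinal lt = 3) //; apply/val_inj.
Qed.

Section ConeMonoid.
Variables (r s a b : int).
Implicit Types v w : 'rV[int]_4.

(* In the basis A, B, xi, eta of the lattice, the cone of V_AB is where these forms
   are nonnegative. Each formA is 1 at A and 0 at B, each formB is 0 at A and 1
   at B. *)
Definition formA v := v 0 0.
Definition formB v := v 0 1.
Definition formA_eta v := v 0 0 + v 0 3.
Definition formB_xi v := v 0 1 + v 0 2.
Definition formA_corner v := v 0 0 + r * b * v 0 2 + r * s * v 0 3.
Definition formB_corner v := v 0 1 + r * s * v 0 2 + a * s * v 0 3.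

Definition in_cone : {pred 'rV[int]_4} := fun v => [&& 0 <= formA v, 0 <= formB v, 0 <=
  formA_eta v, 0 <= formB_xi v,
  0 <= formA_corner v & 0 <= formB_corner v].

Lemma formsD v w :
  [/\ formA (v + w) = formA v + formA w, formB (v + w) = formB v + formB w,
      formA_eta (v + w) = formA_eta v + formA_eta w & formB_xi (v + w) = formB_xi v +
        formB_xi w] /\
  formA_corner (v + w) = formA_corner v + formA_corner w /\
  formB_corner (v + w) = formB_corner v + formB_corner w.
Proof.
rewrite /formA /formB /formA_eta /formB_xi /formA_corner /formB_corner !mxE.
by split; [split|split]; ring.
Qed.

Lemma in_cone_addr_closed : addr_closed in_cone.
Proof.
split=> [|v w]; rewrite !unfold_in /in_cone.
  by rewrite /formA /formB /formA_eta /formB_xi /formA_corner /formB_corner !mxE !mulr0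
    !addr0 lexx.
move=> /and5P[v1 v2 v3 v4 /andP[v5 v6]] /and5P[w1 w2 w3 w4 /andP[w5 w6]].
have [[-> -> -> ->] [-> ->]] := formsD v w.
by apply/and5P; split; [| | | |apply/andP; split]; apply: addr_ge0.
Qed.

Record cone_monoid := ConeMonoid { cone_val : 'rV[int]_4; cone_valP : in_cone cone_val }.

HB.instance Definition _ := [isSub for cone_val].
HB.instance Definition _ := [Choice of cone_monoid by <:].
HB.instance Definition _ :=
  GRing.SubChoice_isSubNmodule.Build _ _ cone_monoid in_cone_addr_closed.


End ConeMonoid.

(* A lattice point of the cone from which neither A nor B can be subtracted lies
   on one of the four faces spanned by S_0, S_1, S_2, S_3. *)
Lemma cone_cases (r s a b m1 m2 m3 m4 c o p q : int) :
  c = m1 + m4 -> o = m2 + m3 -> p = m1 + r * b * m3 + r * s * m4 ->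
  q = m2 + r * s * m3 + a * s * m4 ->
  0 < r -> 0 < s -> 0 <= a -> 0 <= b -> r * s - a * b = 1 ->
  0 <= m1 -> 0 <= m2 -> 0 <= c -> 0 <= o -> 0 <= p -> 0 <= q ->
  [/\ 0 < m1, 0 < c & 0 < p] \/ [/\ 0 < m2, 0 < o & 0 < q] \/
  [\/ p = 0 /\ q = 0, m2 = 0 /\ c = 0, m1 = 0 /\ m2 = 0 | m1 = 0 /\ o = 0].
Proof.
move=> cE oE pE qE r0 s0 a0 b0 det m1_ge0 m2_ge0 c_ge0 o_ge0 p_ge0 q_ge0.
(* With [r * s = 1 + a * b], the corner forms [p] and [q] each have two expressions in [S] and [T],
   so the sign of a form gives the sign of one of these quantities. *)
pose T := r * m3 - a * m1; pose S := s * m4 - b * m2.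
have mul (x y z : int) : y = z -> x * y = x * z by move=> ->.
have rsE : r * s = 1 + a * b by lra.
have p1 : p = r * s * c + b * T.
  by rewrite pE cE /T; have := mul m1 _ _ rsE; lra.
have q1 : q = r * s * o + a * S.
  by rewrite qE oE /S; have := mul m2 _ _ rsE; lra.
have q2 : q = m2 + s * (T + a * c).
  by rewrite qE cE /T; ring.
have p2 : p = m1 + r * (S + b * o).
  by rewrite pE oE /S; ring.
have A0 : (0 < m1 /\ 0 < c /\ 0 < p) \/ (m1 = 0 \/ (c = 0 \/ p = 0))
  by clear -m1_ge0 c_ge0 p_ge0; lia.
have B0 : (0 < m2 /\ 0 < o /\ 0 < q) \/ (m2 = 0 \/ (o = 0 \/ q = 0))
  by clear -m2_ge0 o_ge0 q_ge0; lia.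
case: A0 => [[? [? ?]]|[m10|[c0|p0]]]; first by left.
all: case: B0 => [[? [? ?]]|[m20|[o0|q0]]]; first by right; left.
all: right; right.
- by apply: Or43.
- by apply: Or44.
- apply: Or44; split=> //.
  (* Since [q = 0], this product equals [- o], which forces [o = 0]. The case [m2 = p = 0] is
     symmetric. *)
  have : 0 <= a * (S + b * o).
    by apply: mulr_ge0 => //; rewrite -(pmulr_rge0 _ r0); lra.
  by have := mul o _ _ rsE; lra.
- by apply: Or42.
(* With [c = o = 0] one has [p = b * T], [q = a * S], [m4 = - m1] and [m3 = - m2]. A positive [b]
   gives [T >= 0] and hence [m2 = 0]; a positive [a] with [b = 0] gives [m1 = 0]; if both vanish, so
   do [p] and [q]. *)
- have [bz|bp] : b = 0 \/ 0 < b by clear -b0; lia.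
    have p0 : p = 0 by rewrite p1 c0 bz; ring.
    have [az|ap] : a = 0 \/ 0 < a by lia.
      by apply: Or41; split=> //; rewrite q1 o0 az; ring.
    apply: Or44; split=> //.
    have : 0 <= S by rewrite -(pmulr_rge0 _ ap); rewrite o0 in q1; lra.
    rewrite /S bz (_ : m4 = - m1); last by rewrite cE in c0; lra.
    by rewrite mul0r subr0 mulrN oppr_ge0 pmulr_rle0 //; lra.
  apply: Or42; split=> //.
  have : 0 <= T by rewrite -(pmulr_rge0 _ bp); rewrite c0 in p1; lra.
  rewrite /T (_ : m3 = - m2); last by rewrite oE in o0; lra.
  have := mulr_ge0 a0 m1_ge0; have [->//|m2p] : m2 = 0 \/ 0 < m2 by lia.
  by have := mulr_gt0 r0 m2p; lra.
- have [bz|bp] : b = 0 \/ 0 < b by lia.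
    by apply: Or41; split=> //; rewrite p1 c0 bz; ring.
  apply: Or42; split=> //.
  have T0 : 0 <= T by rewrite -(pmulr_rge0 _ bp); rewrite c0 in p1; lra.
  by have := mulr_ge0 (ltW s0) T0; rewrite c0 in q2; lra.
- apply: Or42; split=> //.
  have : 0 <= b * (T + a * c).
    by apply: mulr_ge0 => //; rewrite -(pmulr_rge0 _ s0); lra.
  by have := mul c _ _ rsE; lra.
- have [az|ap] : a = 0 \/ 0 < a by lia.
    by apply: Or41; split=> //; rewrite q1 o0 az; ring.
  apply: Or44; split=> //.
  have S0 : 0 <= S by rewrite -(pmulr_rge0 _ ap); rewrite o0 in q1; lra.
  by have := mulr_ge0 (ltW r0) S0; rewrite o0 in p2; lra.
by apply: Or41.
Qed.

Section Construction.
Import mpoly.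
Variables (K : fieldType) (r alpha s beta : nat) (a b : int).
Hypothesis primr : exists z : K, r.-primitive_root z.
Hypothesis prims : exists z : K, s.-primitive_root z.
Hypothesis redr : reduced_form r alpha.
Hypothesis reds : reduced_form s beta.
Hypothesis a_ge0 : 0 <= a.
Hypothesis b_ge0 : 0 <= b.
Hypothesis det : r%:Z * s%:Z - a * b = 1.
Hypothesis a_mod : (a = alpha%:Z %[mod r%:Z])%Z.
Hypothesis b_mod : (b = beta%:Z %[mod s%:Z])%Z.
Local Notation k := (cq_top K r alpha).
Local Notation l := (cq_top K s beta).
Local Notation genx := (@cq_gen K r alpha).
Local Notation geny := (@cq_gen K s beta).
Local Notation cone := (cone_monoid r%:Z s%:Z a b).

Let r_gt0 : 0 < r%:Z. Proof. by case: redr. Qed.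
Let s_gt0 : 0 < s%:Z. Proof. by case: reds. Qed.

(** The xi-exponent n in x_i = (A/eta)^u xi^n, for the generator u^u v^v with exponents [genx i];
    the division is exact by the congruence for [a]. *)
Definition coord_x i : int := (((genx i).2%:Z + a * (genx i).1%:Z) %/ r%:Z)%Z.
Definition coord_y j : int := (((geny j).2%:Z + b * (geny j).1%:Z) %/ s%:Z)%Z.

Lemma dvdz_coord (n c e f : nat) (z : int) : (z = c%:Z %[mod n%:Z])%Z ->
  (n %| c * e + f)%N ->
  (n%:Z %| f%:Z + z * e%:Z)%Z.
Proof.
move=> /eqP; rewrite eqz_mod_dvd => /dvdzP[q Eq] d.
have : (n%:Z %| (c * e + f)%N%:Z)%Z by [].
case/dvdzP=> q' Eq'; apply/dvdzP; exists (q' + q * e%:Z).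
rewrite mulrDl -Eq' mulrAC -Eq PoszD PoszM; ring.
Qed.

Lemma coord_xE i : r%:Z * coord_x i = (genx i).2%:Z + a * (genx i).1%:Z.
Proof. by rewrite mulrC divzK // (dvdz_coord a_mod) // cq_gen_inv. Qed.

Lemma coord_yE j : s%:Z * coord_y j = (geny j).2%:Z + b * (geny j).1%:Z.
Proof. by rewrite mulrC divzK // (dvdz_coord b_mod) // cq_gen_inv. Qed.

(* (U, V) and (U', V') are the exponents of the x-part and of the y-part of a
   monomial; its forms are combinations of them with coefficients >= 0. *)
Lemma forms_exponents (v : 'rV[int]_4) (U V U' V' : int) :
  v 0 0 = U -> v 0 1 = U' ->
  r%:Z * v 0 2 = V + a * U - r%:Z * U' -> s%:Z * v 0 3 = V' + b * U' - s%:Z * U ->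
  [/\ r%:Z * formB_xi v = V + a * U, s%:Z * formA_eta v = V' + b * U',
      formA_corner r s b v = b * V + r%:Z * V'
    & formB_corner r s a v = s%:Z * V + a * V'].
Proof.
move=> E0 E1 E2 E3; rewrite /formB_xi /formA_eta /formA_corner /formB_corner E0 E1.
have rsE : r%:Z * s%:Z = 1 + a * b by move: det; lra.
have mul (x y z : int) : y = z -> x * y = x * z by move=> ->.
split.
- by rewrite mulrDr E2; ring.
- by rewrite mulrDr E3; ring.
- have -> : r%:Z * b * v 0 2 = b * (V + a * U - r%:Z * U') by rewrite -E2; ring.
  have -> : r%:Z * s%:Z * v 0 3 = r%:Z * (V' + b * U' - s%:Z * U) by rewrite -E3; ring.
  by have := mul U _ _ rsE; lra.
have -> : r%:Z * s%:Z * v 0 2 = s%:Z * (V + a * U - r%:Z * U') by rewrite -E2; ring.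
have -> : a * s%:Z * v 0 3 = a * (V' + b * U' - s%:Z * U) by rewrite -E3; ring.
by have := mul U' _ _ rsE; lra.
Qed.

Lemma in_cone_exponents (v : 'rV[int]_4) (U V U' V' : nat) :
  v 0 0 = U -> v 0 1 = U' ->
  r%:Z * v 0 2 = V%:Z + a * U%:Z - r%:Z * U'%:Z ->
  s%:Z * v 0 3 = V'%:Z + b * U'%:Z - s%:Z * U%:Z -> in_cone r s a b v.
Proof.
move=> E0 E1 E2 E3; have [F1 F2 F3 F4] := forms_exponents E0 E1 E2 E3.
apply/and5P; split; [by rewrite /formA E0|by rewrite /formB E1| | |apply/andP; split].
- by rewrite -(pmulr_rge0 _ s_gt0) F2 addr_ge0 // mulr_ge0.
- by rewrite -(pmulr_rge0 _ r_gt0) F1 addr_ge0 // mulr_ge0.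
- by rewrite F3 addr_ge0 // mulr_ge0.
by rewrite F4 addr_ge0 // mulr_ge0.
Qed.

Definition vec_x i := row4 (genx i).1 0 (coord_x i) (- (genx i).1%:Z).
Definition vec_y j := row4 0 (geny j).1 (- (geny j).1%:Z) (coord_y j).

Lemma in_cone_x i : in_cone r s a b (vec_x i).
Proof.
have [E0 E1 E2 E3] := row4E (genx i).1 0 (coord_x i) (- (genx i).1%:Z).
apply: (@in_cone_exponents _ (genx i).1 (genx i).2 0 0) => //.
  by rewrite E2 coord_xE; ring.
by rewrite E3; ring.
Qed.

Lemma in_cone_y j : in_cone r s a b (vec_y j).
Proof.
have [E0 E1 E2 E3] := row4E 0 (geny j).1 (- (geny j).1%:Z) (coord_y j).
apply: (@in_cone_exponents _ 0 0 (geny j).1 (geny j).2) => //.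
  by rewrite E2; ring.
by rewrite E3 coord_yE; ring.
Qed.

Definition vec_A := row4 1 0 0 0.
Definition vec_B := row4 0 1 0 0.

Lemma in_cone_ge0 (v : 'rV[int]_4) : (forall i, 0 <= v 0 i) -> in_cone r s a b v.
Proof.
move=> v0; have rs0 : 0 <= r%:Z /\ 0 <= s%:Z by [].
case: rs0 => r0 s0.
by apply/and5P; split; [| | | |apply/andP; split];
  rewrite /formA /formB /formA_eta /formB_xi /formA_corner /formB_corner ?addr_ge0
    ?mulr_ge0.
Qed.

Lemma in_cone_A : in_cone r s a b vec_A.
Proof. by apply: in_cone_ge0 => -[[|[|[|[|//]]]] lt]; rewrite mxE. Qed.

Lemma in_cone_B : in_cone r s a b vec_B.
Proof. by apply: in_cone_ge0 => -[[|[|[|[|//]]]] lt]; rewrite mxE. Qed.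

Definition cone_data : toric_data k l :=
  @ToricData k l cone (\val : {additive cone -> 'rV[int]_4})
    (ConeMonoid in_cone_A) (ConeMonoid in_cone_B)
    (fun i => ConeMonoid (in_cone_x i)) (fun j => ConeMonoid (in_cone_y j)).

Local Notation E := cone_data.
Local Notation vec p := (td_chi E p).

Lemma cone_inj (p q : E) : vec p = vec q -> p = q.
Proof. exact: val_inj. Qed.

Lemma cone_ex v : in_cone r s a b v -> exists p : E, vec p = v.
Proof. by move=> vP; exists (ConeMonoid vP). Qed.

Definition sum1 n (g : 'I_n -> nat * nat) (c : 'I_n -> nat) : nat :=
  (\sum_i c i * (g i).1)%N.
Definition sum2 n (g : 'I_n -> nat * nat) (c : 'I_n -> nat) : nat :=
  (\sum_i c i * (g i).2)%N.

Lemma Posz_sum n (F : 'I_n -> nat) : (\sum_i F i)%N%:Z = \sum_i (F i)%:Z.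
Proof. by rewrite -natz natr_sum; apply: eq_bigr => i _; rewrite natz. Qed.

Lemma vec_td_exp c d : [/\ vec (td_exp E c d) 0 0 = (sum1 genx c)%:Z,
  vec (td_exp E c d) 0 1 = (sum1 geny d)%:Z,
  r%:Z * vec (td_exp E c d) 0 2
    = (sum2 genx c)%:Z + a * (sum1 genx c)%:Z - r%:Z * (sum1 geny d)%:Z
  & s%:Z * vec (td_exp E c d) 0 3
    = (sum2 geny d)%:Z + b * (sum1 geny d)%:Z - s%:Z * (sum1 genx c)%:Z].
Proof.
have entry j : vec (td_exp E c d) 0 j
    = \sum_i vec_x i 0 j * (c i)%:Z + \sum_i vec_y i 0 j * (d i)%:Z.
  rewrite /td_exp raddfD mxE; congr (_ + _); rewrite raddf_sum summxE.
    by apply: eq_bigr => i _; rewrite raddfMn mulrn_scale mxE mulrC.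
  by apply: eq_bigr => i _; rewrite raddfMn mulrn_scale mxE mulrC.
have Ex i := row4E (genx i).1 0 (coord_x i) (- (genx i).1%:Z).
have Ey j := row4E 0 (geny j).1 (- (geny j).1%:Z) (coord_y j).
rewrite !entry /sum1 /sum2 !Posz_sum; split.
- rewrite [X in _ + X]big1 ?addr0 => [|i _]; last by case: (Ey i) => ->; rewrite mul0r.
  by apply: eq_bigr => i _; case: (Ex i) => ->; rewrite PoszM mulrC.
- rewrite [X in X + _]big1 ?add0r => [|i _]; last by case: (Ex i) => _ ->; rewrite mul0r.
  by apply: eq_bigr => i _; case: (Ey i) => _ ->; rewrite PoszM mulrC.
- rewrite mulrDr !mulr_sumr -big_split /= -sumrN; congr (_ + _); apply: eq_bigr => i _.
    by case: (Ex i) => _ _ -> _; rewrite mulrA coord_xE !PoszM; ring.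
  by case: (Ey i) => _ _ -> _; rewrite !PoszM; ring.
rewrite addrC mulrDr !mulr_sumr -big_split /= -sumrN; congr (_ + _);
  apply: eq_bigr => i _.
  by case: (Ey i) => _ _ _ ->; rewrite mulrA coord_yE !PoszM; ring.
by case: (Ex i) => _ _ _ ->; rewrite !PoszM; ring.
Qed.

Lemma forms_ge0 (p : E) :
  [/\ 0 <= formA (vec p), 0 <= formB (vec p), 0 <= formA_eta (vec p) & 0 <= formB_xi
    (vec p)]
  /\ 0 <= formA_corner r s b (vec p) /\ 0 <= formB_corner r s a (vec p).
Proof. by have /and5P[? ? ? ? /andP[? ?]] := cone_valP (p : cone). Qed.

Lemma forms_A : [/\ formA vec_A = 1, formB vec_A = 0, formA_eta vec_A = 1 & formB_xi
  vec_A = 0] /\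
  formA_corner r s b vec_A = 1 /\ formB_corner r s a vec_A = 0.
Proof.
rewrite /formA /formB /formA_eta /formB_xi /formA_corner /formB_corner.
by have [-> -> -> ->] := row4E 1 0 0 0; rewrite !mulr0 !addr0.
Qed.

Lemma forms_B : [/\ formA vec_B = 0, formB vec_B = 1, formA_eta vec_B = 0 & formB_xi
  vec_B = 1] /\
  formA_corner r s b vec_B = 0 /\ formB_corner r s a vec_B = 1.
Proof.
rewrite /formA /formB /formA_eta /formB_xi /formA_corner /formB_corner.
by have [-> -> -> ->] := row4E 0 1 0 0; rewrite !mulr0 !addr0.
Qed.

Definition divisible_A (p : E) :=
  [/\ 0 < formA (vec p), 0 < formA_eta (vec p) & 0 < formA_corner r s b (vec p)].
Definition divisible_B (p : E) :=
  [/\ 0 < formB (vec p), 0 < formB_xi (vec p) & 0 < formB_corner r s a (vec p)].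

(** Subtracting A lowers the three A-forms by one and leaves the B-forms unchanged, so over the
    integers positivity of the A-forms is divisibility. *)
Lemma divisible_AP p : divisible_A p <-> exists q, p = td_A E + q.
Proof.
have [[A1 A2 A3 A4] [A5 A6]] := forms_A; split=> [[p1 p2 p3]|[q ->]].
  have [[_ f2 _ f4] [_ f6]] := forms_ge0 p.
  have [q Eq] : exists q : E, vec q = vec p - vec_A.
    apply: cone_ex; have Ep : vec p = vec_A + (vec p - vec_A) by rewrite addrC subrK.
    have := formsD r s a b vec_A (vec p - vec_A).
    rewrite -Ep A1 A2 A3 A4 A5 A6 => -[[e1 e2 e3 e4] [e5 e6]].
    by apply/and5P; split; [| | | |apply/andP; split]; lia.
  by exists q; apply: cone_inj; rewrite raddfD Eq addrC subrK.
have [[f1 f2 f3 f4] [f5 f6]] := forms_ge0 q.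
have := formsD r s a b vec_A (vec q); rewrite A1 A2 A3 A4 A5 A6 => -[[e1 e2 e3 e4] [e5
  e6]].
rewrite /divisible_A; have -> : vec (td_A E + q) = vec_A + vec q by apply: raddfD.
by split; lia.
Qed.

Lemma divisible_BP p : divisible_B p <-> exists q, p = td_B E + q.
Proof.
have [[A1 A2 A3 A4] [A5 A6]] := forms_B; split=> [[p1 p2 p3]|[q ->]].
  have [[f1 _ f3 _] [f5 _]] := forms_ge0 p.
  have [q Eq] : exists q : E, vec q = vec p - vec_B.
    apply: cone_ex; have Ep : vec p = vec_B + (vec p - vec_B) by rewrite addrC subrK.
    have := formsD r s a b vec_B (vec p - vec_B).
    rewrite -Ep A1 A2 A3 A4 A5 A6 => -[[e1 e2 e3 e4] [e5 e6]].
    by apply/and5P; split; [| | | |apply/andP; split]; lia.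
  by exists q; apply: cone_inj; rewrite raddfD Eq addrC subrK.
have [[f1 f2 f3 f4] [f5 f6]] := forms_ge0 q.
have := formsD r s a b vec_B (vec q); rewrite A1 A2 A3 A4 A5 A6 => -[[e1 e2 e3 e4] [e5
  e6]].
rewrite /divisible_B; have -> : vec (td_B E + q) = vec_B + vec q by apply: raddfD.
by split; lia.
Qed.

Lemma divAB_P p : divAB p <-> divisible_A p \/ divisible_B p.
Proof.
rewrite divisible_AP divisible_BP /divAB; split.
  by case=> q [->|->]; [left|right]; exists q.
by case=> -[q ->]; exists q; [left|right].
Qed.

(** [face0] to [face3] are the faces of the cone belonging to S_0, ..., S_3. *)
Definition face0 (p : E) := formA_corner r s b (vec p) = 0 /\ formB_corner r s a (vec
  p) = 0.
Definition face1 (p : E) := formB (vec p) = 0 /\ formA_eta (vec p) = 0.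
Definition face2 (p : E) := formA (vec p) = 0 /\ formB (vec p) = 0.
Definition face3 (p : E) := formA (vec p) = 0 /\ formB_xi (vec p) = 0.

Lemma divAB_or_face p : divAB p \/ [\/ face0 p, face1 p, face2 p | face3 p].
Proof.
have [[f1 f2 f3 f4] [f5 f6]] := forms_ge0 p.
have [?|[?|?]] := cone_cases (erefl _) (erefl _) (erefl _) (erefl _) r_gt0 s_gt0 a_ge0
  b_ge0 det
  f1 f2 f3 f4 f5 f6.
- by left; apply/divAB_P; left.
- by left; apply/divAB_P; right.
by right.
Qed.

Lemma face_not_divAB p : [\/ face0 p, face1 p, face2 p | face3 p] -> ~ divAB p.
Proof.
move=> F /divAB_P[] [p1 p2 p3]; case: F => [] [f1 f2];
  by rewrite ?f1 ?f2 ?ltxx in p1 p2 p3.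
Qed.

Lemma cone_eq (p q : E) : vec p 0 0 = vec q 0 0 -> vec p 0 1 = vec q 0 1 ->
  r%:Z * vec p 0 2 = r%:Z * vec q 0 2 -> s%:Z * vec p 0 3 = s%:Z * vec q 0 3 -> p = q.
Proof.
move=> e0 e1 e2 e3; apply/cone_inj/row4_eq => //.
  by apply: mulfI e2; rewrite lt0r_neq0.
by apply: mulfI e3; rewrite lt0r_neq0.
Qed.

Lemma sum1_delta n (g : 'I_n -> nat * nat) j m : sum1 g (fun i => m * (i == j))%N = (m
  * (g j).1)%N.
Proof.
rewrite /sum1 (bigD1 j) //= eqxx muln1 big1 ?addn0 // => i /negPf ->.
by rewrite muln0.
Qed.

Lemma sum2_delta n (g : 'I_n -> nat * nat) j m : sum2 g (fun i => m * (i == j))%N = (m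
  * (g j).2)%N.
Proof.
rewrite /sum2 (bigD1 j) //= eqxx muln1 big1 ?addn0 // => i /negPf ->.
by rewrite muln0.
Qed.

Lemma sum_fun0 n (g : 'I_n -> nat * nat) : sum1 g (fun=> 0%N) = 0%N /\ sum2 g (fun=>
  0%N) = 0%N.
Proof. by split; rewrite /sum1 /sum2 big1. Qed.

Lemma nat_of_int (z : int) : 0 <= z -> exists n : nat, z = n.
Proof. by case: z => // n _; exists n. Qed.

Lemma dvdn_coord (n c u v : nat) (z m : int) : (z = c%:Z %[mod n%:Z])%Z ->
  v%:Z = n%:Z * m - z * u%:Z -> (n %| c * u + v)%N.
Proof.
move=> /eqP; rewrite eqz_mod_dvd => /dvdzP[q Eq] Ev.
suff : (n%:Z %| (c * u + v)%N%:Z)%Z by [].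
apply/dvdzP; exists (m - q * u%:Z).
by rewrite mulrBl mulrAC -Eq PoszD PoszM Ev; ring.
Qed.

Lemma face_td_exp p : [\/ face0 p, face1 p, face2 p | face3 p] ->
  exists c d, p = td_exp E c d.
Proof.
have [[f1 f2 f3 f4] [f5 f6]] := forms_ge0 p.
case=> -[]; rewrite /formA_corner /formB_corner /formA /formB /formA_eta /formB_xi in
  f1 f2 f3 f4 f5 f6 *.
- move=> e1 e2; have m1E : vec p 0 0 = r%:Z * - (b * vec p 0 2 + s%:Z * vec p 0 3) by lra.
  have m2E : vec p 0 1 = s%:Z * - (r%:Z * vec p 0 2 + a * vec p 0 3) by lra.
  (* The A-coordinate of the point is [r] times this number, and that of x_0 is [r]; so [P] is the
     exponent of x_0. Likewise [Q] is the exponent of y_0. *)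
  have [P EP] : exists P : nat, - (b * vec p 0 2 + s%:Z * vec p 0 3) = P.
    by apply: nat_of_int; rewrite -(pmulr_rge0 _ r_gt0) -m1E.
  have [Q EQ] : exists Q : nat, - (r%:Z * vec p 0 2 + a * vec p 0 3) = Q.
    by apply: nat_of_int; rewrite -(pmulr_rge0 _ s_gt0) -m2E.
  exists (fun i => P * (i == ord0))%N, (fun j => Q * (j == ord0))%N.
  have [g0 g1 g2 g3] := vec_td_exp (fun i => P * (i == ord0))%N (fun j => Q * (j ==
    ord0))%N.
  rewrite !sum1_delta !sum2_delta (cq_gen0 primr redr) (cq_gen0 prims reds) /= !muln0
    in g0 g1 g2 g3.
  have rsE : r%:Z * s%:Z = 1 + a * b by move: det; lra.
  have mul (x y z : int) : y = z -> x * y = x * z by move=> ->.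
  apply: cone_eq.
  + by rewrite g0 m1E EP PoszM mulrC.
  + by rewrite g1 m2E EQ PoszM mulrC.
  + by rewrite g2 !PoszM -EP -EQ; have := mul (r%:Z * vec p 0 2) _ _ rsE; lra.
  by rewrite g3 !PoszM -EP -EQ; have := mul (s%:Z * vec p 0 3) _ _ rsE; lra.
- move=> e1 e2; have [U EU] := nat_of_int f1.
  (* [(U, V)] is the invariant exponent to be generated; on this face [formB_corner] equals [s * V],
     whence [V >= 0]. *)
  have [V EV] : exists V : nat, r%:Z * vec p 0 2 - a * vec p 0 0 = V.
    apply: nat_of_int; rewrite -(pmulr_rge0 _ s_gt0); move: f6; rewrite e1.
    by have -> : vec p 0 3 = - vec p 0 0 by [lra]; lra.
  have [|c [Ec1 Ec2]] := @newton_generates K r alpha primr redr (U, V).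
    by rewrite /=; apply: (dvdn_coord (m := vec p 0 2) a_mod); rewrite -EV EU.
  exists c, (fun=> 0%N); have [g0 g1 g2 g3] := vec_td_exp c (fun=> 0%N).
  have [z1 z2] := sum_fun0 geny; rewrite z1 z2 /sum1 /sum2 -Ec1 -Ec2 in g0 g1 g2 g3.
  apply: cone_eq; rewrite ?g0 ?g1 ?g2 ?g3 ?EU ?e1 //.
    by rewrite -EV EU; ring.
  by have -> : vec p 0 3 = - vec p 0 0 by [lra]; rewrite EU; ring.
- move=> e1 e2; rewrite e1 e2 !add0r in f3 f4.
  have [P EP] := nat_of_int f4; have [Q EQ] := nat_of_int f3.
  exists (fun i => P * (i == ord_max))%N, (fun j => Q * (j == ord_max))%N.
  have [g0 g1 g2 g3] := vec_td_exp (fun i => P * (i == ord_max))%N (fun j => Q * (j ==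
    ord_max))%N.
  rewrite !sum1_delta !sum2_delta (cq_gen_top primr redr) (cq_gen_top prims reds) /=
    !muln0 in g0 g1 g2 g3.
  by apply: cone_eq; rewrite ?g0 ?g1 ?g2 ?g3 ?e1 ?e2 // ?EP ?EQ PoszM; ring.
move=> e1 e2; have [U EU] := nat_of_int f2.
have [V EV] : exists V : nat, s%:Z * vec p 0 3 - b * vec p 0 1 = V.
  apply: nat_of_int; rewrite -(pmulr_rge0 _ r_gt0); move: f5; rewrite e1.
  by have -> : vec p 0 2 = - vec p 0 1 by [lra]; lra.
have [|c [Ec1 Ec2]] := @newton_generates K s beta prims reds (U, V).
  by rewrite /=; apply: (dvdn_coord (m := vec p 0 3) b_mod); rewrite -EV EU.
exists (fun=> 0%N), c; have [g0 g1 g2 g3] := vec_td_exp (fun=> 0%N) c.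
have [z1 z2] := sum_fun0 genx; rewrite z1 z2 /sum1 /sum2 -Ec1 -Ec2 in g0 g1 g2 g3.
apply: cone_eq; rewrite ?g0 ?g1 ?g2 ?g3 ?EU ?e1 //.
  by have -> : vec p 0 2 = - vec p 0 1 by [lra]; rewrite EU; ring.
by rewrite -EV EU; ring.
Qed.

(** Dividing by A or B lowers [formA + formB] by one; where neither divides, the point lies on a
    face of the tent. *)
Lemma cone_generated p : exists (i j : nat) c d, p = td_A E *+ i + td_B E *+ j + td_exp
  E c d.
Proof.
have [n] := ubnP (absz (formA (vec p) + formB (vec p))); elim: n p => // n IH p ltn.
have [[f1 f2 _ _] _] := forms_ge0 p.
have [[q pq]|/face_td_exp[c [d ->]]] := divAB_or_face p; last first.
  by exists 0%N, 0%N, c, d; rewrite !mulr0n !add0r.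
have [[q1 q2 _ _] _] := forms_ge0 q.
case: pq => pq; rewrite pq in ltn f1 f2 *.
  have [|i [j [c [d ->]]]] := IH q; last by exists i.+1, j, c, d; rewrite mulrS !addrA.
  have [[e1 e2 _ _] _] := formsD r s a b vec_A (vec q).
  have [[A1 A2 _ _] _] := forms_A.
  have E' : vec (td_A E + q) = vec_A + vec q by apply: raddfD.
  by rewrite E' e1 e2 A1 A2 in ltn; lia.
have [|i [j [c [d ->]]]] := IH q; last first.
  by exists i, j.+1, c, d; rewrite mulrS !addrA [td_B E + _]addrC.
have [[e1 e2 _ _] _] := formsD r s a b vec_B (vec q).
have [[A1 A2 _ _] _] := forms_B.
have E' : vec (td_B E + q) = vec_B + vec q by apply: raddfD.
by rewrite E' e1 e2 A1 A2 in ltn; lia.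
Qed.

(** * The tent ideal as the preimage of (A, B) *)

Local Notation mon := 'X_{1..k.+1 + l.+1}.

Lemma tent_ideal_bad (m : mon) i j : m (lshift l.+1 i) != 0%N ->
  m (rshift k.+1 j) != 0%N ->
  (i, j) <> (ord0, ord0) -> (i, j) <> (ord_max, ord_max) ->
  tent_ideal ('X_[m] : {mpoly K[_]}).
Proof.
move=> mi mj n0 n1; set u := (U_(lshift l.+1 i) + U_(rshift k.+1 j))%MM.
have le : (u <= m)%MM.
  apply/mnm_lepP => t; rewrite mnmDE !mnm1E.
  case: eqP => [<-|_]; case: eqP => [Et|_] //=.
  - by have := eq_rlshift j i; rewrite Et eqxx.
  - by move: mi; lia.
  by move: mj; rewrite -Et; lia.
rewrite -(submK le) mpolyXD; apply: in_idealM; rewrite mpolyXD.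
exact: tent_XY.
Qed.

Lemma face_exponents c d :
  [\/ sum2 genx c = 0%N /\ sum2 geny d = 0%N, sum1 geny d = 0%N /\ sum2 geny d = 0%N,
      sum1 genx c = 0%N /\ sum1 geny d = 0%N | sum1 genx c = 0%N /\ sum2 genx c = 0%N] <->
  [\/ face0 (td_exp E c d), face1 (td_exp E c d), face2 (td_exp E c d) | face3 (td_exp
    E c d)].
Proof.
have [g0 g1 g2 g3] := vec_td_exp c d; have [F1 F2 F3 F4] := forms_exponents g0 g1 g2 g3.
have gA : formA (vec (td_exp E c d)) = sum1 genx c by [].
have gB : formB (vec (td_exp E c d)) = sum1 geny d by [].
split=> -[] [e1 e2].
- by apply: Or41; rewrite /face0 F3 F4 e1 e2 !mulr0 addr0.
- apply: Or42; rewrite /face1 gB e1; split=> //.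
  by apply: (mulfI (lt0r_neq0 s_gt0)); rewrite F2 e1 e2 !mulr0 addr0.
- by apply: Or43; rewrite /face2 gA gB e1 e2.
- apply: Or44; rewrite /face3 gA e1; split=> //.
  by apply: (mulfI (lt0r_neq0 r_gt0)); rewrite F1 e1 e2 !mulr0 addr0.
- apply: Or41; rewrite F3 in e1; rewrite F4 in e2.
  have := mulr_ge0 b_ge0 (le0z_nat (sum2 genx c)).
  have := mulr_ge0 a_ge0 (le0z_nat (sum2 geny d)); split.
    have/eqP : s%:Z * (sum2 genx c)%:Z = 0 by have :=
      mulr_ge0 (ltW s_gt0) (le0z_nat (sum2 genx c)); lia.
    by rewrite mulf_eq0 (negPf (lt0r_neq0 s_gt0)) => /eqP[].
  have/eqP : r%:Z * (sum2 geny d)%:Z = 0 by have :=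
    mulr_ge0 (ltW r_gt0) (le0z_nat (sum2 geny d)); lia.
  by rewrite mulf_eq0 (negPf (lt0r_neq0 r_gt0)) => /eqP[].
- apply: Or42; rewrite gB in e1; rewrite e2 e1 !mulr0 addr0 in F2.
  by case: e1 => ->; case: F2 => <-.
- by apply: Or43; rewrite gA in e1; rewrite gB in e2; case: e1; case: e2.
apply: Or44; rewrite gA in e1; rewrite e2 e1 !mulr0 addr0 in F1.
by case: e1 => ->; case: F1 => <-.
Qed.

Lemma sum_eq0_supp n (F c : 'I_n -> nat) j :
  F j = 0%N -> (forall i, c i != 0%N -> i = j) -> (\sum_i c i * F i = 0)%N.
Proof.
move=> Fj cj; apply: big1 => i _; have [->//|/cj ->] := eqVneq (c i) 0%N.
by rewrite Fj muln0.
Qed.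

(** A monomial with no forbidden factor x_i y_j involves only the x_i, or only the y_j, or only x_0
    and y_0, or only x_k and y_l; these are the four faces. *)
Lemma tent_ideal_or_face (m : mon) : tent_ideal ('X_[m] : {mpoly K[_]}) \/
  [\/ face0 (td_mon E m), face1 (td_mon E m), face2 (td_mon E m) | face3 (td_mon E m)].
Proof.
set c := fun i => m (lshift l.+1 i); set d := fun j => m (rshift k.+1 j).
have [[i [j [ci dj n0 n1]]]|no] := EM (exists i j, [/\ c i != 0%N, d j != 0%N,
    (i, j) <> (ord0, ord0) & (i, j) <> (ord_max, ord_max)]).
  by left; apply: tent_ideal_bad ci dj n0 n1.
right; apply/face_exponents; rewrite -/c -/d.
have supp i j : c i != 0%N -> d j != 0%N -> (i, j) = (ord0, ord0) \/ (i, j) = (ord_max,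
  ord_max).
  move=> ci dj; have [->|/eqP n0] := eqVneq (i, j) (ord0, ord0); first by left.
  have [->|/eqP n1] := eqVneq (i, j) (ord_max, ord_max); first by right.
  by case: no; exists i, j.
have k0 : ord_max != ord0 :> 'I_k.+1 by rewrite -val_eqE /= -lt0n cq_top_gt0.
have l0 : ord_max != ord0 :> 'I_l.+1 by rewrite -val_eqE /= -lt0n cq_top_gt0.
have [[j dj]|d0] := EM (exists j, d j != 0%N); last first.
  apply: Or42; rewrite /sum1 /sum2; split; apply: big1 => j _;
  by have [->//|dj] := eqVneq (d j) 0%N; case: d0; exists j.
have [[i ci]|c0] := EM (exists i, c i != 0%N); last first.
  apply: Or44; rewrite /sum1 /sum2; split; apply: big1 => i _;
  by have [->//|ci] := eqVneq (c i) 0%N; case: c0; exists i.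
have [[Ei Ej]|[Ei Ej]] := supp _ _ ci dj; subst i j.
  apply: Or41; split; apply: sum_eq0_supp (ord0) _ _; rewrite ?cq_gen0 // => t ct.
    have [/(congr1 fst) //|/(congr1 snd)/eqP/=] := supp t ord0 ct dj.
    by rewrite eq_sym (negPf l0).
  have [/(congr1 snd) //|/(congr1 fst)/eqP/=] := supp ord0 t ci ct.
  by rewrite eq_sym (negPf k0).
apply: Or43; split; apply: sum_eq0_supp (ord_max) _ _; rewrite ?cq_gen_top // => t ct.
  have [/(congr1 snd)/eqP/=|/(congr1 fst) //] := supp t ord_max ct dj.
  by rewrite (negPf l0).
have [/(congr1 fst)/eqP/=|/(congr1 snd) //] := supp ord_max t ci ct.
by rewrite (negPf k0).
Qed.

(** The A- and B-coordinates recover the u-exponents of the x-part and of the y-part, and then the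
    other two coordinates recover the v-exponents. So the relation splits into one in S_1 and one in
    S_3. *)
Lemma tent_ideal_td_mon (m m' : mon) : td_mon E m = td_mon E m' ->
  tent_ideal ('X_[m] - 'X_[m'] : {mpoly K[_]}).
Proof.
rewrite /td_mon; set c := fun i => m (lshift l.+1 i); set d := fun j => m (rshift k.+1 j).
set c' := fun i => m' (lshift l.+1 i); set d' := fun j => m' (rshift k.+1 j) => Emm.
have [g0 g1 g2 g3] := vec_td_exp c d; have [h0 h1 h2 h3] := vec_td_exp c' d'.
rewrite Emm in g0 g1 g2 g3.
have U : sum1 genx c = sum1 genx c' by move: g0; rewrite h0 => -[].
have U' : sum1 geny d = sum1 geny d' by move: g1; rewrite h1 => -[].
have V : sum2 genx c = sum2 genx c' by move: g2; rewrite h2 U U' => /addIr/addIr[].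
have V' : sum2 geny d = sum2 geny d' by move: g3; rewrite h3 U U' => /addIr/addIr[].
have split_mon (e : mon) : 'X_[e] = 'X_[tent_exp (fun i => e (lshift l.+1 i)) (fun=> 0%N)]
    * 'X_[tent_exp (fun=> 0%N) (fun j => e (rshift k.+1 j))] :> {mpoly K[_]}.
  rewrite -mpolyXD; congr 'X_[_]; rewrite {1}[e]tent_expE; apply/mnmP => t.
  rewrite mnmDE -[t]splitK; case: (split t) => i /=.
    by rewrite !tent_expl addn0.
  by rewrite !tent_expr.
rewrite (split_mon m) (split_mon m') -/c -/d -/c' -/d'.
set X := 'X_[tent_exp c _]; set Y := 'X_[tent_exp _ d].
set X' := 'X_[tent_exp c' _]; set Y' := 'X_[tent_exp _ d'].
have -> : X * Y - X' * Y' = Y * (X - X') + X' * (Y - Y') by ring.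
by apply: in_idealD; apply: in_idealM; [apply: tent_binomial_x|apply: tent_binomial_y].
Qed.

Lemma divAB_cone_XY i j : (i, j) <> (ord0, ord0) -> (i, j) <> (ord_max, ord_max) ->
  divAB (td_x E i + td_y E j).
Proof.
move=> n0 n1; have <- : td_exp E (fun t => 1 * (t == i))%N (fun t => 1 * (t == j))%N
    = td_x E i + td_y E j by rewrite /td_exp !sum_delta !mulr1n.
pose c t := (1 * (t == i))%N; pose d t := (1 * (t == j))%N.
have [//|/face_exponents] := divAB_or_face (td_exp E c d).
rewrite !sum1_delta !sum2_delta !mul1n.
have [_ gi0 _] := cq_gen_nb primr redr i; have [_ gj0 _] := cq_gen_nb prims reds j.
case=> -[/eqP e1 /eqP e2].
- by case: n0; rewrite !cq_gen2_eq0 // in e1 e2; rewrite (eqP e1) (eqP e2).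
- by move: gj0; rewrite [geny j]surjective_pairing (eqP e1) (eqP e2).
- by case: n1; rewrite !cq_gen1_eq0 // in e1 e2; rewrite (eqP e1) (eqP e2).
by move: gi0; rewrite [genx i]surjective_pairing (eqP e1) (eqP e2).
Qed.

(** The ideal of the quotient is spanned by binomials: the coefficient of each monomial in u and v
    is the sum of the [q@_m] over one fibre, and it vanishes. *)
Lemma cq_relation (r' alpha' : nat) (n := cq_top K r' alpha') (V : lmodType K)
    (X : 'X_{1..n.+1} -> V) (q : {mpoly K[n.+1]}) :
  cq_ideal q ->
  (forall m m' : 'X_{1..n.+1},
     sum1 (@cq_gen K r' alpha') m = sum1 (@cq_gen K r' alpha') m' ->
     sum2 (@cq_gen K r' alpha') m = sum2 (@cq_gen K r' alpha') m' -> X m = X m') ->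
  \sum_(m <- msupp q) q@_m *: X m = 0.
Proof.
move=> q0 Xm; pose H (m : 'X_{1..n.+1}) := (sum1 (@cq_gen K r' alpha') m, sum2 (@cq_gen
  K r' alpha') m).
apply: (@formal_relation K V (fun v => v = 0) _ _ (msupp q) (fun m => q@_m) H X).
- by [].
- by move=> u v -> ->; rewrite addr0.
- by move=> c v ->; rewrite scaler0.
- by move=> m m' _ _ [E1 E2]; rewrite (Xm m m' E1 E2) subrr.
move=> t; pose mt : 'X_{1..2} := (U_(ord0) *+ t.1 + U_(ord_max) *+ t.2)%MM.
have uv_coef x : (uv K x)@_mt = (x == t)%:R.
  rewrite uvE mcoeffX -/mt; case: (x =P t) => [->|ne]; first by rewrite eqxx.
  case: eqP => // Ext; case: ne; apply: (@uv_inj K).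
  by rewrite !uvE -/mt Ext.
have E0 := congr1 (mcoeff mt) q0; rewrite mcoeff0 in E0; apply: etrans E0.
rewrite comp_mpolyE raddf_sum [LHS]big_mkcond /=; apply: eq_bigr => m _.
under eq_bigr do rewrite tnth_mktuple.
rewrite mcoeffZ uv_prod uv_coef /H.
by case: eqP; rewrite ?mulr1 ?mulr0.
Qed.

Lemma td_eval_comp n (lq : n.-tuple {mpoly K[k.+1 + l.+1]}) (q : {mpoly K[n]}) :
  td_eval E (q \mPo lq) = \sum_(m <- msupp q) q@_m *: td_eval E ('X_[m] \mPo lq).
Proof.
rewrite {1}[q]mpolyE linear_sum (big_morph _ (@td_evalD _ _ _ _ _ E) (td_eval0 E)).
by apply: eq_bigr => m _; rewrite /= comp_mpolyZ td_evalZ.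
Qed.

Lemma td_eval_cq_x (q : {mpoly K[k.+1]}) : cq_ideal q ->
  td_eval E (q \mPo [tuple tent_X s beta i | i < k.+1]) = 0.
Proof.
move=> q0; rewrite td_eval_comp.
apply: (@cq_relation r alpha _ (fun m => td_eval E ('X_[m] \mPo _)) q q0) => m m' E1 E2.
have mE (e : 'X_{1..k.+1}) : e = [multinom e i | i < k.+1] by apply/mnmP => t;
  rewrite mnmE.
rewrite (mE m) (mE m') -!tent_monomial_x !td_evalX !td_mon_exp; congr character.
have [g0 g1 g2 g3] := vec_td_exp m (fun=> 0%N);
  have [h0 h1 h2 h3] := vec_td_exp m' (fun=> 0%N).
by apply: cone_eq; rewrite ?g0 ?g1 ?g2 ?g3 ?h0 ?h1 ?h2 ?h3 ?E1 ?E2.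
Qed.

Lemma td_eval_cq_y (q : {mpoly K[l.+1]}) : cq_ideal q ->
  td_eval E (q \mPo [tuple tent_Y r alpha i | i < l.+1]) = 0.
Proof.
move=> q0; rewrite td_eval_comp.
apply: (@cq_relation s beta _ (fun m => td_eval E ('X_[m] \mPo _)) q q0) => m m' E1 E2.
have mE (e : 'X_{1..l.+1}) : e = [multinom e i | i < l.+1] by apply/mnmP => t;
  rewrite mnmE.
rewrite (mE m) (mE m') -!tent_monomial_y !td_evalX !td_mon_exp; congr character.
have [g0 g1 g2 g3] := vec_td_exp (fun=> 0%N) m;
  have [h0 h1 h2 h3] := vec_td_exp (fun=> 0%N) m'.
by apply: cone_eq; rewrite ?g0 ?g1 ?g2 ?g3 ?h0 ?h1 ?h2 ?h3 ?E1 ?E2.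
Qed.

Lemma td_ideal_eval p : tent_ideal p -> td_ideal (td_eval E p).
Proof.
apply: (@in_ideal_min _ _ (fun p => td_ideal (td_eval E p))).
- by rewrite td_eval0; apply: in_ideal0.
- by move=> f g; rewrite td_evalD; apply: in_idealD.
move=> f g Gg; have -> : td_eval E (f * g) = td_eval E f * td_eval E g
  by rewrite /td_eval rmorphM.
apply: in_idealM; case: Gg => [q q0|q q0|i j n0 n1].
- by rewrite td_eval_cq_x //; apply: in_ideal0.
- by rewrite td_eval_cq_y //; apply: in_ideal0.
by rewrite td_eval_XY; apply/td_ideal_chr/divAB_cone_XY.
Qed.

(** Terms whose character is divisible by A or B avoid the faces and are in the tent ideal one by
    one. The others are grouped by character and cancel modulo binomials. *)
Lemma tent_ideal_eval p : td_ideal (td_eval E p) -> tent_ideal p.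
Proof.
move=> /td_idealP p_div; rewrite [p]mpolyE.
pose good m := `[< ~ divAB (td_mon E m) >].
rewrite (bigID good) /=; apply: in_idealD; last first.
  rewrite -big_filter; apply: in_ideal_sum => m;
    rewrite mem_filter => /andP[/asboolP/contrapT mdiv _].
  rewrite -mul_mpolyC; apply: in_idealM.
  by have [//|/face_not_divAB] := tent_ideal_or_face m.
rewrite -big_filter; apply: (@formal_relation K _ _ _ _ _ _ (td_mon E)).
- exact: in_ideal0.
- exact: in_idealD.
- by move=> c f; rewrite -mul_mpolyC; apply: in_idealM.
- by move=> m m' _ _; apply: tent_ideal_td_mon.
move=> q; rewrite big_filter_cond.
have [qdiv|qdiv] := EM (divAB q).
  by rewrite big_pred0 // => m; apply/negP => /andP[/asboolP nd /eqP Em]; apply: nd;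
    rewrite Em.
(* A nonzero sum would put [q] in the support of the image, hence make it divisible by A or B. *)
have [//|ne] := eqVneq (\sum_(m <- msupp p | good m && (td_mon E m == q)) p@_m) 0.
case: (qdiv); apply: p_div; rewrite coefficient_td_eval; apply: contra_neq ne => E0;
  apply: etrans E0.
apply: eq_bigl => m; case: (td_mon E m =P q) => [Em|_]; rewrite ?andbF // andbT.
by apply/asboolP; rewrite Em.
Qed.

Lemma cone_union_of_strata : union_of_strata (@td_ideal K r alpha s beta E).
Proof.
exists (fun F => [\/ F = face0, F = face1, F = face2 | F = face3]); split.
  have f0 : [/\ formA (vec (0 : E)) = 0, formB (vec (0 : E)) = 0, formA_eta (vec (0 :
    E)) = 0
      & formB_xi (vec (0 : E)) = 0] /\
      formA_corner r s b (vec (0 : E)) = 0 /\ formB_corner r s a (vec (0 : E)) = 0.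
    rewrite raddf0 /formA /formB /formA_eta /formB_xi /formA_corner /formB_corner !mxE.
    by rewrite !mulr0 !addr0.
  have [[z1 z2 z3 z4] [z5 z6]] := f0.
  move=> F FE; split; first by case: FE => ->; split.
  move=> p q; have [[p1 p2 p3 p4] [p5 p6]] := forms_ge0 p.
  have [[q1 q2 q3 q4] [q5 q6]] := forms_ge0 q.
  have [[e1 e2 e3 e4] [e5 e6]] := formsD r s a b (vec p) (vec q).
  have Epq : vec (p + q) = vec p + vec q by apply: raddfD.
  case: FE => ->; rewrite /face0 /face1 /face2 /face3 Epq ?e1 ?e2 ?e3 ?e4 ?e5 ?e6;
    split; lia.
move=> f; rewrite td_idealP; split=> [H F FE p Fp|H p p0].
  apply/eqP/negPn/negP => /H; apply: face_not_divAB.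
  by case: FE Fp => -> Fp; [apply: Or41|apply: Or42|apply: Or43|apply: Or44].
have [//|F] := divAB_or_face p.
have : coefficient p f = 0 by
  case: F => Fp; [apply: (H face0)|apply: (H face1)|apply: (H face2)|apply: (H face3)]
    => //;
  [apply: Or41|apply: Or42|apply: Or43|apply: Or44].
by move/eqP; rewrite (negPf p0).
Qed.

(** Multiplication by a character shifts the support injectively, so A is not a zero divisor. The
    A-forms vanish at B, so multiplying by B does not affect divisibility by A. The unit lies on
    [face2], hence outside the ideal. *)
Lemma cone_regular :
  regular_sequence2 (character K (td_A E)) (character K (td_B E)).
Proof.
have addI (p q t : E) : p + q = p + t -> q = t.
  by move/(congr1 (td_chi E)); rewrite !raddfD => /addrI/cone_inj.
have coef (p q : E) f : coefficient (p + q) (character K p * f) = coefficient q f.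
  rewrite mulrC coefficient_mul_chr [in RHS](monoid_algE f) coefficient_sum
    [LHS]big_mkcond.
  apply: eq_bigr => t _; rewrite coefficientZ coefficient_chr.
  have -> : (t + p == p + q) = (t == q) by apply/eqP/eqP => [|->];
    rewrite addrC // => /addI.
  by case: eqP; rewrite ?mulr1 ?mulr0.
have idealA f : in_ideal (eq (character K (td_A E))) f <->
    forall p, coefficient p f != 0 -> divisible_A p.
  rewrite (in_ideal_chr (S := fun t => t = td_A E)); last first.
    by move=> g; split=> [<-|[t -> ->] //]; exists (td_A E).
  split=> H p /H; first by case=> t -> ?; apply/divisible_AP.
  by move=> /divisible_AP ?; exists (td_A E).
split.
- move=> f Af; apply: monoid_alg_eq => p.
  by rewrite -(coef (td_A E)) Af !coefficient0.
- move=> f /idealA H; apply/idealA => p p0; have := H (td_B E + p).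
  rewrite coef => /(_ p0); have [[A1 A2 A3 A4] [A5 A6]] := forms_B.
  have := formsD r s a b vec_B (vec p); rewrite A1 A2 A3 A4 A5 A6 => -[[e1 e2 e3 e4]
    [e5 e6]].
  rewrite /divisible_A; have -> : vec (td_B E + p) = vec_B + vec p by apply: raddfD.
  by rewrite e1 e3 e5 !add0r.
move=> /td_ideal_chr; apply: (face_not_divAB (p := 0)); apply: Or43.
by rewrite /face2 raddf0 /formA /formB !mxE.
Qed.

Lemma vec_xi : td_xi E = row4 0 0 1 0.
Proof.
rewrite /td_xi; apply: row4_eq; rewrite !mxE /= ?cq_gen_top //.
by apply: (mulfI (lt0r_neq0 r_gt0)); rewrite coord_xE cq_gen_top //=; ring.
Qed.

Lemma vec_eta : td_eta E = row4 0 0 0 1.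
Proof.
rewrite /td_eta; apply: row4_eq; rewrite !mxE /= ?cq_gen_top //.
by apply: (mulfI (lt0r_neq0 s_gt0)); rewrite coord_yE cq_gen_top //=; ring.
Qed.

Lemma cone_extension : toric_extension E.
Proof.
split.
- exact: val_inj.
(* The cone contains the nonnegative orthant, hence the positive and negative parts of [m]. *)
- move=> m; have pos (v : 'rV[int]_4) : exists p : E, vec p = \row_j Num.max (v 0 j) 0.
    by apply/cone_ex/in_cone_ge0 => i; rewrite mxE le_max lexx orbT.
  have [p Ep] := pos m; have [q Eq] := pos (- m); exists p, q; rewrite Ep Eq.
  apply/rowP => i; rewrite !mxE; have [z0|/ltW z0] := leP 0 (m 0 i).
    by rewrite max_r ?oppr_le0 // subr0.
  by rewrite max_l ?oppr_ge0 // sub0r opprK.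
- move=> m n n0 [p Ep]; apply: cone_ex.
  have := forms_ge0 p; rewrite Ep mulrn_scale /in_cone.
  rewrite /formA /formB /formA_eta /formB_xi /formA_corner /formB_corner !mxE.
  have n1 : 0 < n%:Z by [].
  rewrite -!(mulrCA n%:Z) -!mulrDr !(pmulr_rge0 _ n1) => -[[-> -> -> ->] [-> ->]].
  by [].
- move=> p; have [i [j [c [d ->]]]] := cone_generated p; exists i, j, c, d.
  by rewrite /td_exp addrA.
- exact: cone_regular.
- move=> f; rewrite [f]monoid_algE; elim: (support f) => [|p t [q Hq]].
    by exists 0; rewrite big_nil td_eval0 subr0; apply: in_ideal0.
  rewrite big_cons; have [pdiv|pdiv] := EM (divAB p).
    exists q; rewrite -addrA; apply: in_idealD => //.
    by rewrite -mulr_algl; apply/in_idealM/td_ideal_chr.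
  have [//|/face_td_exp[c [d Ep]]] := divAB_or_face p.
  exists (coefficient p f *: 'X_[tent_exp c d] + q).
  have -> : td_eval E (coefficient p f *: 'X_[tent_exp c d] + q)
      = coefficient p f *: character K p + td_eval E q.
    by rewrite td_evalD td_evalZ td_evalX td_mon_exp -Ep.
  by rewrite opprD addrACA subrr add0r.
- by move=> p; split; [apply: tent_ideal_eval|apply: td_ideal_eval].
- exact: cone_union_of_strata.
(* x_(k-1) has first exponent 1, so a_k is its xi-exponent. *)
- exists (coord_x (inord k.-1)); rewrite vec_xi vec_eta mulrz_scale.
  by apply: row4_eq; rewrite !mxE /= ?cq_gen_subtop //=; ring.
exists (coord_y (inord l.-1)); rewrite vec_xi vec_eta mulrz_scale.
by apply: row4_eq; rewrite !mxE /= ?cq_gen_subtop //=; ring.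
Qed.

Lemma cone_extension_matrix : extension_matrix E (mat2 r a b s).
Proof.
split; rewrite ?mxE //= vec_xi vec_eta !mulrz_scale; apply: row4_eq;
  rewrite !mxE /= ?cq_gen0 //=.
all: try by ring.
  by apply: (mulfI (lt0r_neq0 r_gt0)); rewrite coord_xE cq_gen0 //=; ring.
by apply: (mulfI (lt0r_neq0 s_gt0)); rewrite coord_yE cq_gen0 //=; ring.
Qed.

End Construction.

Theorem theorem2p10 (R : realType) (r alpha s beta : nat)
    (hS1 : reduced_form r alpha) (hS3 : reduced_form s beta) :
  (forall E : toric_data (cq_top R[i] r alpha) (cq_top R[i] s beta),
     toric_extension E ->
     exists2 M : 'M[int]_2, admissible_matrix r alpha s beta M &
       forall M' : 'M[int]_2, extension_matrix E M' <-> M' = M) /\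
  (forall M : 'M[int]_2, admissible_matrix r alpha s beta M ->
     exists E : toric_data (cq_top R[i] r alpha) (cq_top R[i] s beta),
       toric_extension E /\ extension_matrix E M) /\
  (forall (E E' : toric_data (cq_top R[i] r alpha) (cq_top R[i] s beta))
          (M M' : 'M[int]_2),
     toric_extension E -> toric_extension E' ->
     extension_matrix E M -> extension_matrix E' M' ->
     (toric_extension_iso E E' <-> M = M')) /\
  ((r, s) <> (1%N, 1%N) ->
     (forall M : 'M[int]_2, admissible_matrix r alpha s beta M ->
        [/\ M 0 1 = alpha%:Z, (alpha %| r * s - 1)%N
          & M 1 0 = ((r * s - 1) %/ alpha)%N%:Z] \/
        [/\ M 1 0 = beta%:Z, (beta %| r * s - 1)%N
          & M 0 1 = ((r * s - 1) %/ beta)%N%:Z]) /\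
     (exists sols : seq 'M[int]_2,
        [/\ uniq sols, (size sols <= 2)%N &
            forall M : 'M[int]_2,
              M \in sols <-> admissible_matrix r alpha s beta M])).
Proof.
have r_gt0 : (0 < r)%N by case: hS1.
have s_gt0 : (0 < s)%N by case: hS3.
have primr : exists z : R[i], r.-primitive_root z.
  by apply: closed_field_prim_root; rewrite pnatr_eq0 -lt0n.
have prims : exists z : R[i], s.-primitive_root z.
  by apply: closed_field_prim_root; rewrite pnatr_eq0 -lt0n.
split; [|split; [|split]] => [E te|M adm|E E' M M' te te' EM EM'|rs1].
- have [a [b [_ _ Eab _ _]]] := extension_matrix_ex primr prims hS1 hS3 te.
  exists (mat2 r a b s); first exact: extension_matrix_admissible te Eab.
  by move=> M; split=> [EM|-> //]; apply: extension_matrix_inj te EM Eab.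
- have [[M00 M11] det [a0 b0] amod bmod] := adm.
  rewrite det_mat2 M00 M11 in det.
  exists (cone_data primr prims hS1 hS3 a0 b0 det amod bmod); split.
    exact: cone_extension.
  have := cone_extension_matrix primr prims hS1 hS3 a0 b0 det amod bmod.
  by rewrite (_ : mat2 _ _ _ _ = M) //; apply: mat2_eq; rewrite mxE.
- split=> [iso|EMM']; last by subst M'; apply: extension_iso EM EM'.
  apply: (extension_matrix_inj primr prims hS1 hS3 te' _ EM').
  exact: extension_iso_matrix iso.
split=> [M|]; first exact: admissible_matrix_entries.
exact: admissible_matrix_finite.
Qed.
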